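(* Let $\mathbb L$ be a finite nonempty set of integers $\ge2$ with maximum element $L$, and let $\mathcal H=\bigcup_{\ell\in\mathbb L}\mathcal H_\ell$ be an inhomogeneous non-uniform Erdős–Rényi hypergraph on $[N]$ in which an $\ell$-subset $\{i_1,\dots,i_\ell\}$ is a hyperedge with probability $d_{i_1,\dots,i_\ell}/\binom{N-1}{\ell-1}$. Put $d_\ell:=\max d_{i_1,\dots,i_\ell}$ (maximum over $\ell$-subsets) and $d:=\sum_{\ell\in\mathbb L}(\ell-1)d_\ell$. Let $A$ be the adjacency matrix of $\mathcal H$, let $\tau>1$ be a constant, and define the (random) index set $$\mathcal I=\{i\in[N]:\ \mathrm{row}(i)\le\tau d\}.$$ Then for any $\theta>0$, with $$C_\tau:=2\big((5L+1)(L-1)+\alpha_0\sqrt\tau\big),\qquad \alpha_0:=16+\frac{32}{\tau}(1+e^2)+128L(L-1)(\theta+4)\Big(1+\frac1{e^2}\Big),$$ one has, with probability at least $1-2(e/2)^{-N}-N^{-\theta}$, $$\|A_{\mathcal I}-(\mathbb EA)_{\mathcal I}\|\le C_\tau\sqrt d .$$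
   Context: Inhomogeneous Erdős–Rényi hypergraph: for each $\ell\in\mathbb L$ let $Q^{(\ell)}$ be a symmetric tensor of order $\ell$ on $[N]$ with entries in $[0,1]$; here $Q^{(\ell)}_{i_1,\dots,i_\ell}=d_{i_1,\dots,i_\ell}/\binom{N-1}{\ell-1}$. In $\mathcal H_\ell$ each set $e=\{i_1,\dots,i_\ell\}$ of $\ell$ distinct vertices is a hyperedge with probability $Q^{(\ell)}_{i_1,\dots,i_\ell}$, all independently (over all $e$ and all $\ell\in\mathbb L$); $\mathcal H=\bigcup_{\ell\in\mathbb L}\mathcal H_\ell$. Adjacency matrix: $A$ is the $N\times N$ symmetric matrix with $A_{ii}=0$ and, for $i\ne j$, $A_{ij}$ = the number of hyperedges of $\mathcal H$ (of all sizes) containing both $i$ and $j$. Row sum: $\mathrm{row}(i)=\sum_jA_{ij}$. For an $N\times N$ matrix $M$ and $\mathcal I\subset[N]$, $M_{\mathcal I}$ is the $N\times N$ matrix obtained by zeroing out the rows and columns not indexed by $\mathcal I$: $(M_{\mathcal I})_{ij}=\mathbf 1\{i,j\in\mathcal I\}M_{ij}$. $\|\cdot\|$ is the spectral norm. *)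

(* Defs.v *)
From HB Require Import structures.
From mathcomp Require Import all_boot all_order all_algebra finmap.
From mathcomp Require Import all_classical all_reals all_analysis.

Set Implicit Arguments.
Unset Strict Implicit.
Unset Printing Implicit Defensive.

Import Order.TTheory GRing.Theory Num.Theory.
Import numFieldNormedType.Exports.

Local Open Scope ring_scope.

Definition mutually_independent_events (R : realType) (disp : measure_display)
    (Omega : measurableType disp) (P : probability Omega R) (T : finType)
    (D : {set T}) (E : T -> set Omega) : Prop :=
  forall F : {set T}, F \subset D ->
    P (\bigcap_(x in [set` F]) E x)%classic = (\prod_(x in F) P (E x))%E.

Section Hypergraph.
Variables (R : realType) (N : nat).
Implicit Types (LL : {fset nat}) (H : {set {set 'I_N}}).

Definition possible_edges LL : {set {set 'I_N}} :=
  [set e : {set 'I_N} | #|e| \in LL]%SET.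

(* A symmetric tensor of order l matters only at tuples of distinct indices,
   where it is a function of the underlying l-subset; [dt e] stands for
   d_{i_1,...,i_l} with e = {i_1,...,i_l}, for all orders l at once. *)
Definition edge_prob (dt : {set 'I_N} -> R) (e : {set 'I_N}) : R :=
  dt e / 'C(N.-1, #|e|.-1)%:R.

(* When l > N there is no l-subset of [N], and the maximum is read as 0. *)
Definition dmax (dt : {set 'I_N} -> R) (l : nat) : R :=
  \big[Num.max/0]_(e : {set 'I_N} | #|e| == l) dt e.

Definition dtot LL (dt : {set 'I_N} -> R) : R :=
  \sum_(l <- LL) l.-1%:R * dmax dt l.

Definition adjacency H : 'M[R]_N :=
  \matrix_(i, j) if i == j then 0
                 else #|[set e in H | (i \in e) && (j \in e)]%SET|%:R.

Definition row_sum (M : 'M[R]_N) (i : 'I_N) : R := \sum_j M i j.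

Definition restrict_mx (I : {set 'I_N}) (M : 'M[R]_N) : 'M[R]_N :=
  \matrix_(i, j) if (i \in I) && (j \in I) then M i j else 0.

Definition low_rows (M : 'M[R]_N) (t : R) : {set 'I_N} :=
  [set i | row_sum M i <= t]%SET.

Definition norm2 (x : 'cV[R]_N) : R := Num.sqrt (\sum_i x i 0 ^+ 2).

Definition spectral_norm (M : 'M[R]_N) : R :=
  sup [set norm2 (M *m x) | x in [set x : 'cV[R]_N | norm2 x <= 1]]%classic.

End Hypergraph.

Section RandomHypergraph.
Context (R : realType) (disp : measure_display) (Omega : measurableType disp).
Variables (P : probability Omega R) (N : nat).

(* [H w] is the union of the uniform hypergraphs of all orders l in LL; the one
   of order l consists of the hyperedges of cardinality l. *)
Record inhomogeneous_ER (LL : {fset nat}) (dt : {set 'I_N} -> R)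
    (H : Omega -> {set {set 'I_N}}) : Prop := InhomogeneousER {
  ER_tensor : forall e, e \in possible_edges N LL -> 0 <= edge_prob dt e <= 1;
  ER_support : forall w, H w \subset possible_edges N LL;
  ER_measurable : forall e, measurable [set w | e \in H w]%classic;
  ER_prob : forall e, e \in possible_edges N LL ->
    P [set w | e \in H w]%classic = (edge_prob dt e)%:E;
  ER_independent :
    mutually_independent_events P (possible_edges N LL)
      (fun e => [set w | e \in H w]%classic) }.

(* [fine] loses nothing: the entries of the adjacency matrix are bounded, so
   their expectations are finite. *)
Definition expected_adjacency (H : Omega -> {set {set 'I_N}}) : 'M[R]_N :=
  \matrix_(i, j) fine ('E_P[fun w => adjacency R (H w) i j])%E.

End RandomHypergraph.

Definition alpha0 (R : realType) (L : nat) (tau theta : R) : R :=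
  16 + 32 / tau * (1 + expR 1 ^+ 2)
  + 128 * L%:R * (L%:R - 1) * (theta + 4) * (1 + 1 / expR 1 ^+ 2).

Definition Ctau (R : realType) (L : nat) (tau theta : R) : R :=
  2 * ((5 * L%:R + 1) * (L%:R - 1) + alpha0 L tau theta * Num.sqrt tau).

(* Main.v *)
Require Import Defs.
From mathcomp Require Import all_boot all_order all_algebra finmap.
From mathcomp Require Import all_classical all_reals all_analysis.
From mathcomp Require Import measurable_realfun ring lra.

(* The Friedman-Kahn-Szemeredi method.  By polarization, the norm of the
   centred matrix is at most twice the supremum of its quadratic form over the
   vectors y_i = +-a_i / (4 sqrt N), a_i a natural number, in the unit ball.
   There are at most 64^N of them, and zeroing coordinates of such a vector gives
   another one, so that restricting to the random index set costs no union
   bound.  For each y the pairs (i, j) are split.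

   Light pairs, |y_i y_j| <= sqrt d / N: the centred sum is a sum of independent
   bounded variables indexed by the hyperedges, to which Bernstein's inequality
   applies.

   Heavy pairs: the mean part is at most 3/2 sqrt d, as |y_i y_j| is at most
   (y_i y_j)^2 N / sqrt d.  For the random part, with probability 1 - N^-theta
   all blocks S x T satisfy a discrepancy inequality; a dyadic decomposition of
   a, together with the bound tau d on the row sums, then gives O(sqrt (tau d)). *)

Set Implicit Arguments.
Unset Strict Implicit.
Unset Printing Implicit Defensive.

Import Order.TTheory GRing.Theory Num.Theory.
Import numFieldNormedType.Exports.

Local Open Scope ring_scope.

(** The entries of the adjacency matrix are dependent, as one hyperedge feeds up to [L * (L - 1)]
    ordered pairs. Every linear statistic of the matrix is therefore rewritten as a sum over
    hyperedges, which are independent; the price is a factor [K = L * (L - 1)] in each deviation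
    bound. The index set depends on the hypergraph. Both good events concern the unrestricted matrix
    and hold for all net vectors, respectively all blocks, at once, so the index set may be read off
    afterwards. The failure probabilities are budgets: [64 ^ N] net vectors against a Bernstein
    exponent [7 N] leave [(e / 2) ^ - N], and the exponent [theta + 4] in the discrepancy bound pays
    for the choice of the two sets and of their sizes. The probability space enters only through the
    law of the hypergraph, a weight function on a finite type. Two cases escape the method:
    [N <= 2], where the claimed probability is not positive, and [d = 0], where no scale [sqrt d]
    exists but both restricted matrices vanish. *)

Section ExpBounds.
Context {R : realType}.
Implicit Types x t y : R.

Lemma expR_le_quad x : `|x| <= 2^-1 -> expR x <= 1 + x + 2 * x ^+ 2.
Proof.
rewrite ler_norml => /andP[x1 x2].
have h := expR_ge1Dx (- x).
(* The product equals [1 + x ^ 2 * (1 - 2 * x)]; this is where [x <= 1 / 2] is needed. *)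
have : 1 <= (1 - x) * (1 + x + 2 * x ^+ 2) by nra.
have e0 := expR_gt0 x; move: h; rewrite expRN => h h1.
have x3 : 0 < 1 - x by lra.
have h2 : expR x * (1 - x) <= 1.
  have := ler_wpM2l (ltW e0) h; rewrite mulfV ?expR_eq0//.
rewrite -(ler_pM2l x3); lra.
Qed.

(** Convexity: the tangent inequality at [t * x], taken at 0 and at [x], is averaged with weights
    [1 - t] and [t]. *)
Lemma expR_secant t x : 0 <= t <= 1 -> expR (t * x) <= 1 + t * (expR x - 1).
Proof.
move=> /andP[t0 t1].
have e0 := expR_gt0 (t * x).
have h1 : expR (t * x) * (1 - t * x) <= 1.
  have := ler_wpM2l (ltW e0) (expR_ge1Dx (- (t * x))).
  by rewrite -expRD subrr expR0.
have h2 : expR (t * x) * (1 + (1 - t) * x) <= expR x.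
  have := ler_wpM2l (ltW e0) (expR_ge1Dx ((1 - t) * x)).
  by rewrite -expRD (_ : t * x + (1 - t) * x = x); last ring.
have t2 : 0 <= 1 - t by lra.
have := ler_wpM2l t2 h1; have := ler_wpM2l t0 h2.
set E := expR (t * x) => a1 a2.
have -> : E = (1 - t) * (E * (1 - t * x)) + t * (E * (1 + (1 - t) * x)) by ring.
lra.
Qed.

Lemma expR_subr1_le x : expR x - 1 <= x * expR x.
Proof.
have := ler_wpM2l (expR_ge0 x) (expR_ge1Dx (- x)).
rewrite -expRD subrr expR0; lra.
Qed.

Lemma ln_le_subr1 y : 0 < y -> ln y <= y - 1.
Proof.
by move=> y0; have := expR_ge1Dx (ln y); rewrite lnK ?posrE//; lra.
Qed.

(** The case [N = 2] of the theorem requires [(e / 2) ^ 2 <= 2], hence an upper bound below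
    [2 * sqrt 2]; [e <= (16 / 15) ^ 16] is sharp enough. *)
Lemma expR1_bounds : 2 <= expR (1 : R) <= 281 / 100.
Proof.
apply/andP; split; first by have := expR_ge1Dx (1 : R); lra.
have h := expR_ge1Dx (- (16^-1) : R).
have h1 : expR (16^-1) <= 16 / 15 :> R.
  move: h; rewrite expRN => h.
  have e0 := expR_gt0 (16^-1 : R).
  have := ler_wpM2l (ltW e0) h; rewrite mulfV ?expR_eq0//; lra.
have -> : (1 : R) = 16%:R * 16^-1 by rewrite mulfV// pnatr_eq0.
rewrite expRM_natl.
apply: (@le_trans _ _ ((16 / 15) ^+ 16)).
  by rewrite lerXn2r ?nnegrE ?expR_ge0//; lra.
lra.
Qed.

End ExpBounds.

Section GeometricSums.
Context {R : realType}.
Implicit Types b x y : R.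

Lemma sum_geo_le x m : 0 <= x < 1 -> \sum_(i < m) x ^+ i <= (1 - x)^-1.
Proof.
move=> /andP[x0 x1].
have x2 : 0 < 1 - x by rewrite subr_gt0.
rewrite -(ler_pM2l x2) mulfV ?gt_eqF//.
have -> : (1 - x) * \sum_(i < m) x ^+ i = 1 - x ^+ m.
  by have := subrX1 x m; lra.
by rewrite lerBlDr lerDl exprn_ge0.
Qed.

(** If the last power passes the cut, even the complete sum is small enough: it telescopes to
    [b ^ (m + 1) - 1], at most [b * y]. *)
Lemma sum_geo_cut b y m : 1 < b -> 0 <= y ->
  (b - 1) * \sum_(i < m | b ^+ i <= y) b ^+ i <= b * y.
Proof.
move=> b1 y0; have b0 : 0 < b by lra.
rewrite big_mkcond; elim: m => [|m IH]; first by rewrite big_ord0; nra.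
rewrite big_ord_recr/=.
case: ifP => [h|_]; last by rewrite addr0.
apply: (@le_trans _ _ ((b - 1) * (\sum_(i < m) b ^+ i + b ^+ m))).
  apply: ler_wpM2l; first by lra.
  rewrite lerD2r.
  by apply: ler_sum => i _; case: ifP => // _; rewrite exprn_ge0// ltW.
rewrite mulrDr -subrX1.
by rewrite (_ : _ + _ = b * b ^+ m - 1); [nra|ring].
Qed.

(** Serves to absorb [ln (4 ^ j)] when [3 ^ j] is replaced by [4 ^ j]. The induction step gains
    [j / 3], which is at least 1 only from [j = 3] on. *)
Lemma nat_le_geo43 (j : nat) : (j%:R <= 3 / 2 * (4 / 3) ^+ j :> R).
Proof.
elim: j => [|j IH]; first by rewrite expr0; lra.
case: j IH => [_|[_|[_|j IH]]]; rewrite ?expr1; try lra.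
rewrite exprS -natr1.
have : 3%:R <= j.+3%:R :> R by rewrite ler_nat.
lra.
Qed.

End GeometricSums.

(** * Discrepancy and the contribution of heavy pairs *)

Section Discrepancy.
Context {R : realType} (N : nat).
Implicit Types (A : 'I_N -> 'I_N -> R) (S T : {set 'I_N}).

Definition block_sum A S T : R := \sum_(u in S) \sum_(v in T) A u v.

(** The logarithm of [e * N / #|T|], so that [#|T| * log_card T] is the entropy of the choice of a
    set of at most [#|T|] vertices. *)
Definition log_card T : R := 1 + ln (N%:R / #|T|%:R).

(* The two exponents [1] and [log_card T / 2] of the exponential moment method
   are kept as two linear bounds, instead of the usual dichotomy
   e <= C mu or e ln (e / mu) <= C |T| ln (e N / |T|). *)
Definition discrepancy A (d kappa : R) : Prop :=
  forall S T, (0 < #|T|)%N -> (#|S| <= #|T|)%N ->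
    block_sum A S T <= 3 * (d / N%:R) * (#|S|%:R * #|T|%:R)
                       + kappa * (#|T|%:R * log_card T) /\
    block_sum A S T <= 3 / 2 * (d / N%:R) * (#|S|%:R * #|T|%:R)
                         * expR (log_card T / 2) + 2 * kappa * #|T|%:R.

Lemma log_card_ge1 T : (0 < #|T|)%N -> 1 <= log_card T.
Proof.
move=> T0; rewrite lerDl ln_ge0// ler_pdivlMr ?ltr0n//.
by rewrite mul1r ler_nat (leq_trans (max_card _))// card_ord.
Qed.

End Discrepancy.

Section DyadicLevels.
Context {R : realType} (N : nat) (a : 'I_N -> nat).
Hypothesis a_sq : (\sum_u a u ^ 2 <= 16 * N)%N.

(** Positivity is required because [trunc_log 2 0] is 0. The larger coordinate of a pair is sorted
    by shells but the smaller one by superlevel sets: shell [i] lies in superlevel set [j] whenever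
    [j <= i], which yields the comparison of cardinalities that the discrepancy property demands. *)
Definition shell i : {set 'I_N} := [set u | (0 < a u)%N && (trunc_log 2 (a u) == i)]%SET.
Definition suplevel j : {set 'I_N} := [set v | (2 ^ j <= a v)%N]%SET.

Lemma shell_bounds u i : u \in shell i -> (2 ^ i <= a u < 2 ^ i.+1)%N.
Proof. by rewrite inE => /andP[a0 /eqP <-]; exact: trunc_log_bounds. Qed.

Lemma shell_sub_suplevel i j : (j <= i)%N -> shell i \subset suplevel j.
Proof.
move=> ji; apply/fintype.subsetP => u /shell_bounds/andP[h _].
by rewrite inE (leq_trans _ h)// leq_exp2l.
Qed.

Lemma sum_sq_natr : \sum_u (a u)%:R ^+ 2 <= 16 * N%:R :> R.
Proof.
rewrite (eq_bigr (fun u => (a u ^ 2)%:R)) => [|u _]; last by rewrite natrX.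
by rewrite -natr_sum -natrM ler_nat.
Qed.

Lemma sum_card_shell m : \sum_(i < m) 4 ^+ i * #|shell i|%:R <= 16 * N%:R :> R.
Proof.
apply: le_trans sum_sq_natr.
under eq_bigr => i _ do rewrite -sum1_card natr_sum mulr_sumr big_mkcond.
rewrite exchange_big; apply: ler_sum => u _ /=.
have [um|um] := ltnP (trunc_log 2 (a u)) m; last first.
  rewrite big1 ?sqr_ge0// => i _; case: ifP => //.
  by rewrite inE => /andP[_ /eqP h]; move: um; rewrite h leqNgt ltn_ord.
rewrite (bigD1 (Ordinal um))//= big1 => [|i iu]; last first.
  case: ifP => //; rewrite inE => /andP[_ /eqP h].
  by move: iu; rewrite -val_eqE/= h eqxx.
rewrite addr0; case: ifP; rewrite ?sqr_ge0// => /shell_bounds/andP[h _].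
rewrite mulr1 -natrX -natrX ler_nat (_ : 4 = 2 ^ 2)%N// -expnM mulnC expnM.
by rewrite leq_exp2r.
Qed.

(** The superlevel sets overlap, but one vertex contributes a geometric sum of ratio 4 cut at
    [a u ^ 2], so the overlap costs only a factor [4 / 3] against the shells. *)
Lemma sum_card_suplevel m :
  3 * \sum_(j < m) 4 ^+ j * #|suplevel j|%:R <= 64 * N%:R :> R.
Proof.
suff: \sum_(u : 'I_N) (4 - 1) * \sum_(j < m | 4 ^+ j <= (a u)%:R ^+ 2 :> R) 4 ^+ j
    <= 64 * N%:R :> R.
  rewrite -mulr_sumr; apply: le_trans; rewrite (_ : 4 - 1 = 3); last by ring.
  rewrite ler_wpM2l//.
  under eq_bigr => i _ do rewrite -sum1_card natr_sum mulr_sumr big_mkcond.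
  rewrite exchange_big; apply: ler_sum => u _ /=.
  rewrite [leRHS]big_mkcond; apply: ler_sum => j _; rewrite inE mulr1.
  rewrite -!natrX ler_nat (_ : 4 = 2 ^ 2)%N// -expnM mulnC expnM leq_exp2r//.
apply: (@le_trans _ _ (\sum_u 4 * (a u)%:R ^+ 2)).
  by apply: ler_sum => u _; apply: sum_geo_cut; rewrite ?sqr_ge0//; lra.
by rewrite -mulr_sumr; have := sum_sq_natr; lra.
Qed.

Lemma card_suplevel j : 4 ^+ j * #|suplevel j|%:R <= 16 * N%:R :> R.
Proof.
apply: le_trans sum_sq_natr; rewrite -sum1_card natr_sum mulr_sumr.
rewrite [leLHS]big_mkcond; apply: ler_sum => v _.
case: ifP => [|_]; last exact: sqr_ge0.
rewrite inE mulr1 -!natrX ler_nat => h.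
by rewrite (_ : 4 = 2 ^ 2)%N// -expnM mulnC expnM leq_exp2r.
Qed.

End DyadicLevels.

(** [G1] and [G2] stand for the geometric series of ratios [3 / 4] and [2 / 3]. The terms free of
    [k] give [48 * 64 / 3 + 672 * 3 = 3040], the others [8 * 68 + 4 * 64 / 3 < 630]. *)
Lemma dyadic_total {R : realType} (r s n k G1 G2 SB : R) :
  0 <= r -> r <= s -> 0 <= n -> 0 <= k -> G1 <= 4 -> G2 <= 3 -> SB <= 64 / 3 * n ->
  48 * r * SB + 8 * k * r * (G1 * n + 3 * SB) + 672 * r * n * G2 + 4 * k * s * SB
  <= s * n * (3040 + 630 * k).
Proof.
move=> r0 rs n0 k0 g1 g2 sb.
have s0 : 0 <= s := le_trans r0 rs.
have rn0 : 0 <= r * n := mulr_ge0 r0 n0.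
have q1 : r * n <= s * n := ler_wpM2r n0 rs.
have p1 : r * SB <= r * (64 / 3 * n) := ler_wpM2l r0 sb.
have p2 : r * n * G2 <= r * n * 3 := ler_wpM2l rn0 g2.
have p3 : G1 * n + 3 * SB <= 68 * n by have := ler_wpM2r n0 g1; lra.
have p4 : k * r * (G1 * n + 3 * SB) <= k * r * (68 * n) := ler_wpM2l (mulr_ge0 k0 r0) p3.
have p5 : k * s * SB <= k * s * (64 / 3 * n) := ler_wpM2l (mulr_ge0 k0 s0) sb.
have p6 : k * (r * n) <= k * (s * n) := ler_wpM2l k0 q1.
have p7 : 0 <= k * (s * n) := mulr_ge0 k0 (mulr_ge0 s0 n0).
lra.
Qed.

Section HeavyPairs.
Context {R : realType} (N : nat).
Variables (a : 'I_N -> nat) (A : 'I_N -> 'I_N -> R) (d D kappa : R).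
Hypotheses (N_gt0 : (0 < N)%N) (d_gt0 : 0 < d) (le_dD : d <= D).
Hypothesis kappa_ge0 : 0 <= kappa.
Hypothesis a_sq : (\sum_u a u ^ 2 <= 16 * N)%N.
Hypothesis A_ge0 : forall u v, 0 <= A u v.
Hypothesis A_sym : forall u v, A u v = A v u.
Hypothesis A_row : forall u, (0 < a u)%N -> \sum_v A u v <= D.
Hypothesis A_disc : discrepancy A d kappa.

Let Sh i := shell a i.
Let Sj j := suplevel a j.

Let N_gt0R : 0 < N%:R :> R. Proof. by rewrite ltr0n. Qed.

(** With [s] the cardinality, [ln x <= x - 1] is applied at [x = N / (4 ^ j * s)], since [4 ^ j * s]
    has order at most [N]; the remaining [ln (4 ^ j) <= 2 * j] is absorbed by the passage from
    [3 ^ j] to [4 ^ j]. *)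
Lemma suplevel_log j : (0 < #|Sj j|)%N ->
  3 ^+ j * (#|Sj j|%:R * log_card (Sj j))
  <= (3 / 4) ^+ j * N%:R + 3 * (4 ^+ j * #|Sj j|%:R) :> R.
Proof.
move=> s0; set s : R := #|Sj j|%:R; have {}s0 : 0 < s by rewrite ltr0n.
rewrite /log_card -/s.
have p4 : 0 < 4 ^+ j :> R by rewrite exprn_gt0.
have ln4 : ln (4 ^+ j) <= 2 * j%:R :> R.
  rewrite lnXn// -[leLHS]mulr_natr ler_wpM2r//.
  rewrite (_ : 4 = 2 ^+ 2 :> R); last by ring.
  by rewrite lnXn// mulr2n; have := @ln_le_subr1 R 2; lra.
have lnN : ln (N%:R / s) <= N%:R / (4 ^+ j * s) - 1 + 2 * j%:R.
  rewrite (_ : N%:R / s = (N%:R / (4 ^+ j * s)) * 4 ^+ j); last first.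
    by field; rewrite !gt_eqF.
  have h : 0 < N%:R / (4 ^+ j * s) by rewrite divr_gt0// mulr_gt0.
  rewrite lnM ?posrE//; have := ln_le_subr1 h; lra.
have p3 : 0 < 3 ^+ j :> R by rewrite exprn_gt0.
have h1 : s * (1 + ln (N%:R / s)) <= N%:R / 4 ^+ j + 2 * j%:R * s.
  apply: (@le_trans _ _ (s * (N%:R / (4 ^+ j * s) + 2 * j%:R))).
    by rewrite ler_pM2l//; lra.
  by rewrite mulrDr (_ : s * (N%:R / _) = N%:R / 4 ^+ j);
    [lra|field; rewrite !gt_eqF].
apply: (le_trans (ler_wpM2l (ltW p3) h1)).
rewrite mulrDr lerD//; first by rewrite expr_div_n; lra.
have := @nat_le_geo43 R j; rewrite expr_div_n => h2.
rewrite (_ : 3 * (4 ^+ j * s) = 3 ^+ j * s * (2 * (3 / 2 * (4 ^+ j / 3 ^+ j)))); last first.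
  by field; rewrite gt_eqF.
rewrite (_ : 3 ^+ j * (2 * j%:R * s) = 3 ^+ j * s * (2 * j%:R)); last by ring.
by rewrite ler_pM2l ?mulr_gt0//; lra.
Qed.

(** The exponential is the square root of [e * N / s], with [s] the cardinality. The square of the
    left side is thus [(4 ^ j * s) * e * N], at most [16 * 3 * N ^ 2], below [49 * N ^ 2]. *)
Lemma suplevel_exp j : (0 < #|Sj j|)%N ->
  2 ^+ j * (#|Sj j|%:R * expR (log_card (Sj j) / 2)) <= 7 * N%:R :> R.
Proof.
move=> s0; set s : R := #|Sj j|%:R; have {}s0 : 0 < s by rewrite ltr0n.
have := @card_suplevel R N a a_sq j; rewrite -/(Sj j) -/s => hs.
rewrite -(@ler_pXn2r _ 2)// ?nnegrE; last 2 first.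
- by rewrite !mulr_ge0 ?expR_ge0 ?exprn_ge0// ltW.
- by rewrite mulr_ge0.
have /andP[e2 e3] := @expR1_bounds R.
have E2 : expR (log_card (Sj j) / 2) ^+ 2 = expR 1 * (N%:R / s).
  rewrite -expRM_natl (_ : 2 * (log_card (Sj j) / 2) = log_card (Sj j)); last by field.
  by rewrite /log_card expRD lnK ?posrE ?divr_gt0.
have q2 : (2 ^+ j) ^+ 2 = 4 ^+ j :> R.
  by rewrite -exprM mulnC exprM (_ : 2 ^+ 2 = 4 :> R)//; ring.
rewrite !exprMn q2 E2.
rewrite (_ : 4 ^+ j * _ = (4 ^+ j * s) * (expR 1 * N%:R)); last first.
  by field; rewrite gt_eqF.
apply: (@le_trans _ _ (16 * N%:R * (3 * N%:R))).
  apply: ler_pM => //; rewrite ?mulr_ge0 ?expR_ge0 ?exprn_ge0 ?(ltW s0)//.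
  by rewrite ler_wpM2r//; lra.
nra.
Qed.

(* For [2 ^ i <= sqrt d (3 / 2) ^ j] the discrepancy bound with exponent 1 is
   used, otherwise the one with exponent [log_card / 2]; the factor [(3 / 2) ^ j]
   makes the resulting series in [j] converge geometrically in both regimes. *)
Lemma dyadic_term i j : (j <= i)%N -> 4 * Num.sqrt d <= 2 ^+ i * 2 ^+ j ->
    2 ^+ i <= Num.sqrt D * 2 ^+ j / 4 ->
  4 * (2 ^+ i * 2 ^+ j) * block_sum A (Sh i) (Sj j) <=
    3 * (Num.sqrt d / N%:R) * (4 ^+ i * #|Sh i|%:R) * (4 ^+ j * #|Sj j|%:R)
  + (if 2 ^+ i <= Num.sqrt d * (3 / 2) ^+ j then 2 ^+ i else 0)
    * (4 * kappa * (2 ^+ j * (#|Sj j|%:R * log_card (Sj j))))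
  + 42 * Num.sqrt d * (2 / 3) ^+ j * (4 ^+ i * #|Sh i|%:R)
  + (if 2 ^+ i <= Num.sqrt D * 2 ^+ j / 4 then 2 ^+ i else 0)
    * (8 * kappa * (2 ^+ j * #|Sj j|%:R)).
Proof.
move=> ji hv near; rewrite near.
have hsub := subset_leq_card (shell_sub_suplevel a ji).
set r := Num.sqrt d; have r0 : 0 < r by rewrite sqrtr_gt0.
have dr : d = r ^+ 2 by rewrite sqr_sqrtr ?ltW.
set p := 2 ^+ i in hv near *; set q := 2 ^+ j in hv near *.
have p0 : 0 < p by rewrite exprn_gt0.
have q0 : 0 < q by rewrite exprn_gt0.
have -> : 4 ^+ i = p ^+ 2 :> R.
  by rewrite -exprM mulnC exprM (_ : 2 ^+ 2 = 4 :> R)//; ring.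
have -> : 4 ^+ j = q ^+ 2 :> R.
  by rewrite -exprM mulnC exprM (_ : 2 ^+ 2 = 4 :> R)//; ring.
have [s0|s0] := posnP #|Sj j|.
  have -> : block_sum A (Sh i) (Sj j) = 0.
    rewrite /block_sum big1// => u _; rewrite big_pred0// => v.
    by rewrite (finset.cards0_eq s0) inE.
  have -> : #|Sh i| = 0%N by apply/eqP; rewrite -leqn0 -s0.
  by rewrite s0 !(mulr0, mul0r, addr0).
have [dp1 dp2] := A_disc s0 hsub.
have hE := suplevel_exp s0.
have X1 := @log_card_ge1 R N _ s0.
rewrite -/q in hE.
set s : R := #|Sj j|%:R in dp1 dp2 hE *; set n : R := #|Sh i|%:R in dp1 dp2 *.
have {}s0 : 0 < s by rewrite ltr0n.
have n0 : 0 <= n by [].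
set X := log_card (Sj j) in dp1 dp2 hE X1 *.
set f := block_sum _ _ _ in dp1 dp2 *.
have pq0 : 0 < 4 * (p * q) by rewrite !mulr_gt0.
have t1 : 0 <= 3 * (r / N%:R) * (p ^+ 2 * n) * (q ^+ 2 * s).
  by rewrite !mulr_ge0 ?sqr_ge0 ?invr_ge0// ltW.
have t3 : 0 <= 42 * r * (2 / 3) ^+ j * (p ^+ 2 * n).
  by rewrite !mulr_ge0 ?sqr_ge0 ?(ltW r0)// exprn_ge0// divr_ge0.
have t4 : 0 <= p * (8 * kappa * (q * s)).
  by rewrite !mulr_ge0// ltW.
case: ifPn => [low|].
  suff: 4 * (p * q) * f <= 3 * (r / N%:R) * (p ^+ 2 * n) * (q ^+ 2 * s)
      + p * (4 * kappa * (q * (s * X))) by lra.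
  apply: (le_trans (ler_wpM2l (ltW pq0) dp1)).
  rewrite mulrDr lerD//; last by rewrite le_eqVlt; apply/orP; left; apply/eqP; ring.
  (* Heaviness, [4 * r <= p * q], trades one of the two factors [r] of [d] for a second copy of both
     dyadic weights. *)
  rewrite dr.
  rewrite (_ : 4 * (p * q) * _ = 3 * (r / N%:R) * (p * q * n * s) * (4 * r)); last by ring.
  rewrite [leRHS](_ : _ = 3 * (r / N%:R) * (p * q * n * s) * (p * q)); last by ring.
  by rewrite ler_wpM2l// !mulr_ge0 ?invr_ge0// ltW.
rewrite -ltNge mul0r addr0 => high.
suff: 4 * (p * q) * f <= 42 * r * (2 / 3) ^+ j * (p ^+ 2 * n)
    + p * (8 * kappa * (q * s)) by lra.
apply: (le_trans (ler_wpM2l (ltW pq0) dp2)).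
rewrite mulrDr lerD//; last by rewrite le_eqVlt; apply/orP; left; apply/eqP; ring.
rewrite dr.
set E := expR _ in hE *.
rewrite [leLHS](_ : _ = 6 * (p * r * r * n) / N%:R * (q * (s * E))); last first.
  by field; rewrite gt_eqF.
apply: (@le_trans _ _ (6 * (p * r * r * n) / N%:R * (7 * N%:R))).
  by rewrite ler_wpM2l// !mulr_ge0 ?invr_ge0// ltW.
rewrite [leLHS](_ : _ = 42 * r * p * n * r); last by field; rewrite gt_eqF.
rewrite [leRHS](_ : _ = 42 * r * p * n * (p * (2 / 3) ^+ j)); last by ring.
rewrite ler_wpM2l// ?mulr_ge0 ?(ltW r0) ?(ltW p0)//.
(* In this regime [r < p * (2 / 3) ^ j], which supplies both the second factor [p] and the decay in
   [j]. *)
have g0 : 0 < (2 / 3) ^+ j :> R by rewrite exprn_gt0//; lra.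
have := ler_wpM2r (ltW g0) (ltW high).
by rewrite -mulrA -exprMn (_ : 3 / 2 * (2 / 3) = 1 :> R) ?expr1n ?mulr1//; field.
Qed.

Let m := (16 * N).+1.

Let lev_lt u : (trunc_log 2 (a u) < m)%N.
Proof.
rewrite ltnS; apply: leq_trans a_sq; rewrite (bigD1 u)//=.
apply: leq_trans (leq_addr _ _).
have [->//|a0] := posnP (a u).
have /andP[h _] := trunc_log_bounds (isT : (1 < 2)%N) a0.
apply: leq_trans (_ : a u <= _)%N; last by rewrite expnS expn1 leq_pmulr.
by apply: leq_trans h; apply: ltnW; exact: ltn_expl.
Qed.

(** The second condition is heaviness at the scale of levels. The third excludes pairs of very
    unequal coordinates, which the row sums control; it also cuts the sum of [2 ^ i] over [i] at
    order [sqrt D * 2 ^ j]. *)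
Definition near_levels (p : 'I_m * 'I_m) : bool :=
  [&& (p.2 <= p.1)%N, 4 * Num.sqrt d <= 2 ^+ p.1 * 2 ^+ p.2
    & 2 ^+ p.1 <= Num.sqrt D * 2 ^+ p.2 / 4].

Let D_gt0 : 0 < D. Proof. exact: lt_le_trans d_gt0 le_dD. Qed.

(** If the levels are far apart, then [sqrt D * a v <= 8 * a u] and the pair is charged to
    [a u ^ 2]. Otherwise the levels of [u] and [v] themselves form an admissible index, and
    [a u * a v] is at most four times the product of their powers of 2; the other indices only add
    nonnegative terms. *)
Lemma heavy_pair_le u v : (0 < a v <= a u)%N ->
    16 * Num.sqrt d < (a u)%:R * (a v)%:R ->
  (a u)%:R * (a v)%:R * A u v <= 8 / Num.sqrt D * ((a u)%:R ^+ 2 * A u v)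
    + \sum_(p | near_levels p) 4 * (2 ^+ p.1 * 2 ^+ p.2)
        * (if (u \in Sh p.1) && (v \in Sj p.2) then A u v else 0).
Proof.
move=> /andP[av0 avu] hv.
have au0 : (0 < a u)%N by exact: leq_trans av0 avu.
have /andP[u1 u2] := trunc_log_bounds (isT : (1 < 2)%N) au0.
have /andP[v1 v2] := trunc_log_bounds (isT : (1 < 2)%N) av0.
set i := trunc_log 2 (a u) in u1 u2; set j := trunc_log 2 (a v) in v1 v2.
have s0 : 0 < Num.sqrt D by rewrite sqrtr_gt0.
have u1R : 2 ^+ i <= (a u)%:R :> R by rewrite -natrX ler_nat.
have u2R : (a u)%:R <= 2 * 2 ^+ i :> R by rewrite -exprS -natrX ler_nat ltnW.
have v2R : (a v)%:R <= 2 * 2 ^+ j :> R by rewrite -exprS -natrX ler_nat ltnW.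
have tail0 (P : pred ('I_m * 'I_m)) : 0 <= \sum_(p | P p) 4 * (2 ^+ p.1 * 2 ^+ p.2)
        * (if (u \in Sh p.1) && (v \in Sj p.2) then A u v else 0).
  apply: sumr_ge0 => p _; rewrite !mulr_ge0 ?exprn_ge0//.
  by case: ifP.
have [near|far] := leP (2 ^+ i) (Num.sqrt D * 2 ^+ j / 4); last first.
  rewrite -[leLHS]addr0 lerD//.
  rewrite mulrA ler_wpM2r// expr2 mulrA mulrC ler_wpM2r//.
  rewrite -(ler_pM2l s0) mulrA.
  rewrite [leRHS](_ : _ = 8 * (a u)%:R); last by field; rewrite gt_eqF.
  have := ler_wpM2l (ltW s0) v2R; lra.
have ji : (j <= i)%N by exact: leq_trunc_log.
pose p : 'I_m * 'I_m := (Ordinal (lev_lt u), Ordinal (lev_lt v)).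
have np : near_levels p.
  rewrite /near_levels/= ji near andbT/=.
  have : (a u)%:R * (a v)%:R <= (2 * 2 ^+ i) * (2 * 2 ^+ j) :> R by rewrite ler_pM.
  lra.
rewrite (bigD1 p)//= /Sh /Sj !inE au0 eqxx/= v1.
rewrite -[leLHS]add0r lerD//; first by rewrite !mulr_ge0 ?invr_ge0 ?(ltW s0).
rewrite -[leLHS]addr0 lerD// ?tail0//.
rewrite ler_wpM2r//.
have : (a u)%:R * (a v)%:R <= (2 * 2 ^+ i) * (2 * 2 ^+ j) :> R by rewrite ler_pM.
rewrite -/i -/j; lra.
Qed.

Lemma sum_dyadic_block :
  \sum_(p | near_levels p) 4 * (2 ^+ p.1 * 2 ^+ p.2)
     * block_sum A (Sh p.1) (Sj p.2)
  <= Num.sqrt D * N%:R * (3040 + 630 * kappa).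
Proof.
set r := Num.sqrt d; set s := Num.sqrt D.
have r0 : 0 < r by rewrite sqrtr_gt0.
have rs : r <= s by rewrite ler_wsqrtr.
have s0 : 0 < s by exact: lt_le_trans rs.
pose be (i : nat) : R := 4 ^+ i * #|Sh i|%:R.
pose B (j : nat) : R := 4 ^+ j * #|Sj j|%:R.
pose c (y : R) (i : nat) : R := if 2 ^+ i <= y then 2 ^+ i else 0.
have be0 i : 0 <= be i by rewrite mulr_ge0 ?exprn_ge0.
have B0 j : 0 <= B j by rewrite mulr_ge0 ?exprn_ge0.
have c0 y i : 0 <= c y i by rewrite /c; case: ifP => // _; rewrite exprn_ge0.
have sbe : \sum_(i < m) be i <= 16 * N%:R by exact: sum_card_shell.
have sB : 3 * \sum_(j < m) B j <= 64 * N%:R by exact: sum_card_suplevel.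
have sc y : 0 <= y -> \sum_(i < m) c y i <= 2 * y.
  move=> y0; have := @sum_geo_cut R 2 y m ltac:(lra) y0.
  by rewrite /c big_mkcond (_ : 2 - 1 = 1 :> R) ?mul1r//; ring.
have X0 j : 0 <= log_card (Sj j) :> R.
  have [h|h] := posnP #|Sj j|; last by have := @log_card_ge1 R N _ h; lra.
  by rewrite /log_card h invr0 mulr0 ln0// addr0.
pose W (i j : 'I_m) := 3 * (r / N%:R) * be i * B j
   + c (r * (3 / 2) ^+ j) i * (4 * kappa * (2 ^+ j * (#|Sj j|%:R * log_card (Sj j))))
   + 42 * r * (2 / 3) ^+ j * be i
   + c (s * 2 ^+ j / 4) i * (8 * kappa * (2 ^+ j * #|Sj j|%:R)).
apply: (@le_trans _ _ (\sum_(p : 'I_m * 'I_m) W p.1 p.2)).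
  rewrite big_mkcond; apply: ler_sum => p _; case: ifP => [/and3P[h1 h2 h3]|_].
    exact: dyadic_term.
  by rewrite /W !addr_ge0// !mulr_ge0 ?exprn_ge0 ?invr_ge0 ?divr_ge0 ?(ltW r0).
rewrite -(pair_bigA _ W)/=.
rewrite exchange_big/=.
(* The sum over [i] goes first: the shells contribute at most [16 N], and the cut powers of 2 at
   most twice their cut. In the second term [(3 / 2) ^ j * 2 ^ j] becomes the [3 ^ j] of
   [suplevel_log]. *)
apply: (@le_trans _ _ (\sum_(j < m)
  (48 * r * B j + 8 * kappa * r * ((3 / 4) ^+ j * N%:R + 3 * B j)
   + 672 * r * N%:R * (2 / 3) ^+ j + 4 * kappa * s * B j))).
  apply: ler_sum => j _; rewrite !big_split/= -!mulr_suml -!mulr_sumr.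
  have h1 := sc (r * (3 / 2) ^+ j) ltac:(by rewrite mulr_ge0 ?exprn_ge0 ?(ltW r0)//; lra).
  have h2 := sc (s * 2 ^+ j / 4) ltac:(by rewrite !mulr_ge0 ?exprn_ge0 ?(ltW s0)).
  rewrite !lerD//.
  - rewrite ler_wpM2r//.
    apply: (@le_trans _ _ (3 * (r / N%:R) * (16 * N%:R))).
      by rewrite ler_wpM2l// !mulr_ge0 ?invr_ge0// ltW.
    by rewrite le_eqVlt; apply/orP; left; apply/eqP; field; rewrite gt_eqF.
  - apply: (le_trans (ler_wpM2r _ h1)).
      by rewrite !mulr_ge0 ?exprn_ge0.
    rewrite [leLHS](_ : _ = 8 * kappa * r
        * (((3 / 2) ^+ j * 2 ^+ j) * (#|Sj j|%:R * log_card (Sj j)))); last by ring.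
    rewrite -exprMn (_ : 3 / 2 * 2 = 3 :> R); last by field.
    rewrite ler_wpM2l ?mulr_ge0 ?(ltW r0)//.
    have [h|h] := posnP #|Sj j|; last exact: suplevel_log.
    by rewrite h mul0r mulr0 addr_ge0// !mulr_ge0 ?exprn_ge0 ?h//; lra.
  - rewrite [leRHS](_ : _ = 42 * r * (2 / 3) ^+ j * (16 * N%:R)); last by ring.
    by rewrite ler_wpM2l// !mulr_ge0 ?exprn_ge0 ?(ltW r0)//; lra.
  - apply: (le_trans (ler_wpM2r _ h2)).
      by rewrite !mulr_ge0 ?exprn_ge0.
    rewrite /B (_ : 4 = 2 * 2 :> R); last by ring.
    by rewrite exprMn le_eqVlt; apply/orP; left; apply/eqP; field.
rewrite !big_split/= -!mulr_sumr big_split/= -mulr_suml -mulr_sumr.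
have g1 : \sum_(j < m) (3 / 4) ^+ j <= 4 :> R.
  apply: le_trans (_ : (1 - 3 / 4)^-1 <= _); first by apply: sum_geo_le; lra.
  by rewrite le_eqVlt; apply/orP; left; apply/eqP; field.
have g2 : \sum_(j < m) (2 / 3) ^+ j <= 3 :> R.
  apply: le_trans (_ : (1 - 2 / 3)^-1 <= _); first by apply: sum_geo_le; lra.
  by rewrite le_eqVlt; apply/orP; left; apply/eqP; field.
set SB := \sum_(j < m) B j in sB *.
set G1 := \sum_(j < m) _ in g1 *; set G2 := \sum_(j < m) _ in g2 *.
have SB' : SB <= 64 / 3 * N%:R by lra.
by apply: dyadic_total => //; exact: ltW.
Qed.

(** The far pairs give [8 / sqrt D * D * 16 N = 128 * sqrt D * N] by the row bound, applied to the
    row of the larger coordinate; the near pairs give the rest. *)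
Lemma heavy_half :
  \sum_u \sum_(v | (0 < a v <= a u)%N && (16 * Num.sqrt d < (a u)%:R * (a v)%:R))
     (a u)%:R * (a v)%:R * A u v
  <= Num.sqrt D * N%:R * (3168 + 630 * kappa).
Proof.
pose F u v := 8 / Num.sqrt D * ((a u)%:R ^+ 2 * A u v).
pose G u v := \sum_(p | near_levels p) 4 * (2 ^+ p.1 * 2 ^+ p.2)
        * (if (u \in Sh p.1) && (v \in Sj p.2) then A u v else 0).
have s0 : 0 < Num.sqrt D by rewrite sqrtr_gt0.
have F0 u v : 0 <= F u v.
  apply: mulr_ge0; first by apply: divr_ge0 => //; exact: ltW.
  by apply: mulr_ge0; first exact: sqr_ge0.
have G0 u v : 0 <= G u v.
  apply: sumr_ge0 => p _; apply: mulr_ge0; last by case: ifP.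
  by rewrite !mulr_ge0 ?exprn_ge0.
apply: (@le_trans _ _ (\sum_u \sum_v (F u v + G u v))).
  apply: ler_sum => u _; rewrite big_mkcond; apply: ler_sum => v _.
  case: ifP => [/andP[h1 h2]|_]; last exact: addr_ge0.
  exact: heavy_pair_le.
under eq_bigr => u _ do rewrite big_split.
rewrite big_split/=.
have hF : \sum_u \sum_v F u v <= 128 * (Num.sqrt D * N%:R).
  apply: (@le_trans _ _ (\sum_u 8 * Num.sqrt D * (a u)%:R ^+ 2)).
    apply: ler_sum => u _; rewrite -mulr_sumr -mulr_sumr.
    have [->|au] := posnP (a u); first by rewrite expr0n/= !(mul0r, mulr0).
    apply: (@le_trans _ _ (8 / Num.sqrt D * ((a u)%:R ^+ 2 * D))).
      rewrite ler_wpM2l ?divr_ge0 ?(ltW s0)// ler_wpM2l ?sqr_ge0//.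
      exact: A_row.
    rewrite -[X in _ * (_ * X)](sqr_sqrtr (ltW D_gt0)) le_eqVlt; apply/orP; left.
    by apply/eqP; field; rewrite gt_eqF.
  rewrite -mulr_sumr; have := ler_wpM2l (ltW s0) (@sum_sq_natr R N a a_sq).
  lra.
have hG : \sum_u \sum_v G u v <= Num.sqrt D * N%:R * (3040 + 630 * kappa).
  apply: le_trans sum_dyadic_block; rewrite le_eqVlt; apply/orP; left; apply/eqP.
  under eq_bigr => u _ do rewrite exchange_big.
  rewrite exchange_big; apply: eq_bigr => p _.
  rewrite /block_sum mulr_sumr [RHS]big_mkcond; apply: eq_bigr => u _.
  rewrite -mulr_sumr; case: (u \in Sh p.1) => /=; last first.
    by rewrite big1 ?mulr0.
  by rewrite -big_mkcond.
lra.
Qed.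

Lemma heavy_sum_le :
  \sum_u \sum_(v | 16 * Num.sqrt d < (a u)%:R * (a v)%:R)
     (a u)%:R * (a v)%:R * A u v
  <= Num.sqrt D * N%:R * (6336 + 1260 * kappa).
Proof.
pose P u v := (0 < a v <= a u)%N && (16 * Num.sqrt d < (a u)%:R * (a v)%:R).
pose g u v := (a u)%:R * (a v)%:R * A u v.
have g0 u v : 0 <= g u v by rewrite /g !mulr_ge0.
apply: (@le_trans _ _ (\sum_u \sum_(v | P u v) g u v + \sum_u \sum_(v | P u v) g u v)).
  have {1}-> : \sum_u \sum_(v | P u v) g u v = \sum_u \sum_(v | P v u) g u v.
    under eq_bigr => u _ do rewrite big_mkcond.
    rewrite exchange_big; apply: eq_bigr => u _.
    rewrite [RHS]big_mkcond; apply: eq_bigr => v _.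
    by rewrite /g A_sym ; case: ifP => // _; ring.
  rewrite -big_split; apply: ler_sum => u _.
  rewrite big_mkcond [X in _ <= X + _]big_mkcond [X in _ <= _ + X]big_mkcond.
  rewrite -big_split/=; apply: ler_sum => v _.
  have h0 : 0 <= 16 * Num.sqrt d by rewrite mulr_ge0 ?sqrtr_ge0.
  case: ifP => h; last by rewrite addr_ge0//; case: ifP.
  have : 0 < (a u)%:R * (a v)%:R :> R by exact: le_lt_trans h.
  rewrite -natrM ltr0n muln_gt0 => /andP[u0 v0].
  rewrite /P [(a v)%:R * _]mulrC h u0 v0 !andbT/=.
  case: (leqP (a v) (a u)) => [_|/ltnW ->].
    by rewrite natrM -/(g u v) lerDr; case: ifP.
  by rewrite natrM -/(g u v) addr0.
have := heavy_half; rewrite -/P -/g; lra.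
Qed.

End HeavyPairs.

(** * Reduction of the spectral norm to a lattice net *)

Section QuadraticForms.
Context {R : realType} (N : nat).
Variable M : 'M[R]_N.
Hypothesis M_sym : forall i j, M i j = M j i.
Implicit Types x y u v : 'I_N -> R.

Definition sqnorm x : R := \sum_i x i ^+ 2.
Definition bilin (M : 'M[R]_N) x y : R := \sum_i \sum_j M i j * (x i * y j).

Lemma sqnorm_ge0 x : 0 <= sqnorm x.
Proof. by apply: sumr_ge0 => i _; exact: sqr_ge0. Qed.

Lemma sqnormZ c x : sqnorm (fun i => c * x i) = c ^+ 2 * sqnorm x.
Proof. by rewrite /sqnorm mulr_sumr; apply: eq_bigr => i _; rewrite exprMn. Qed.

Lemma sqnorm_par u v : sqnorm (fun i => u i + v i) + sqnorm (fun i => u i - v i)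
  = 2 * (sqnorm u + sqnorm v).
Proof.
by rewrite /sqnorm -!big_split mulr_sumr; apply: eq_bigr => i _ /=; ring.
Qed.

Lemma sqnorm_coord x i : sqnorm x <= 1 -> `|x i| <= 1.
Proof.
move=> h; rewrite -(@ler_pXn2r _ 2)// ?nnegrE// expr1n real_normK ?num_real//.
apply: le_trans h; rewrite /sqnorm (bigD1 i)//= lerDl.
by apply: sumr_ge0 => j _; exact: sqr_ge0.
Qed.

Lemma bilinC u v : bilin M u v = bilin M v u.
Proof.
rewrite /bilin exchange_big; apply: eq_bigr => i _; apply: eq_bigr => j _.
by rewrite M_sym; ring.
Qed.

Lemma bilinZ c x y : bilin M (fun i => c * x i) y = c * bilin M x y.
Proof.
by rewrite /bilin mulr_sumr; apply: eq_bigr => i _; rewrite mulr_sumr;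
  apply: eq_bigr => j _; ring.
Qed.

Lemma bilinZZ c x : bilin M (fun i => c * x i) (fun i => c * x i) = c ^+ 2 * bilin M x x.
Proof. by rewrite bilinZ bilinC bilinZ; ring. Qed.

Lemma bilin_polar u v :
  bilin M (fun i => u i + v i) (fun i => u i + v i)
  - bilin M (fun i => u i - v i) (fun i => u i - v i) = 4 * bilin M u v.
Proof.
transitivity (2 * bilin M u v + 2 * bilin M v u); last by rewrite bilinC; ring.
rewrite /bilin !mulr_sumr -sumrN -!big_split/=; apply: eq_bigr => i _.
by rewrite !mulr_sumr -sumrN -!big_split/=; apply: eq_bigr => j _; ring.
Qed.

Lemma bilin_diff_sq x y : bilin M x x - bilin M y y
  = bilin M (fun i => x i - y i) (fun i => x i + y i).
Proof.
transitivity (bilin M x x - bilin M y y + (bilin M x y - bilin M y x)).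
  by rewrite [bilin M x y]bilinC; ring.
rewrite /bilin -!sumrN -!big_split/=; apply: eq_bigr => i _.
by rewrite -!sumrN -!big_split/=; apply: eq_bigr => j _; ring.
Qed.

(** With the sign kept apart from a natural numerator, the unit ball condition reads
    [\sum_i a i ^ 2 <= 16 * N], and a coordinate is erased by setting [a i] to 0. *)
Definition lattice_vec (b : 'I_N -> bool) (a : 'I_N -> nat) (i : 'I_N) : R :=
  (-1) ^+ b i * (a i)%:R / (4 * Num.sqrt N%:R).

Lemma sqnorm_lattice b a : (0 < N)%N -> (\sum_i a i ^ 2 <= 16 * N)%N ->
  sqnorm (lattice_vec b a) <= 1.
Proof.
move=> N0 ha; have N0R : 0 < N%:R :> R by rewrite ltr0n.
rewrite /sqnorm (eq_bigr (fun i => (a i ^ 2)%:R / (16 * N%:R))) => [|i _].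
  rewrite -mulr_suml -natr_sum ler_pdivrMr ?mulr_gt0// mul1r.
  by rewrite -natrM ler_nat.
rewrite /lattice_vec !exprMn sqrr_sign mul1r exprVn exprMn sqr_sqrtr ?ltW// natrX.
by congr (_ / (_ * _)); ring.
Qed.

Lemma lattice_vec_norm b a i j : (0 < N)%N ->
  `|lattice_vec b a i * lattice_vec b a j|
  = (a i)%:R * (a j)%:R / (16 * N%:R) :> R.
Proof.
move=> N0; have N0R : 0 < N%:R :> R by rewrite ltr0n.
rewrite /lattice_vec !normrM !normr_sign !normfV !normrM !normr_nat.
rewrite (ger0_norm (sqrtr_ge0 _)) !mul1r.
rewrite -[in RHS](sqr_sqrtr (ler0n R N)).
by field; rewrite gt_eqF// sqrtr_gt0.
Qed.

Lemma sum_lattice_sq b a : (0 < N)%N -> (\sum_i a i ^ 2 <= 16 * N)%N ->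
  \sum_i \sum_j (lattice_vec b a i * lattice_vec b a j) ^+ 2 <= 1 :> R.
Proof.
move=> N0 ha; have := sqnorm_lattice b N0 ha.
set s := sqnorm _ => hs.
have -> : \sum_i \sum_j (lattice_vec b a i * lattice_vec b a j) ^+ 2 = s ^+ 2 :> R.
  rewrite expr2 /s /sqnorm mulr_suml; apply: eq_bigr => i _.
  by rewrite mulr_sumr; apply: eq_bigr => j _; rewrite exprMn.
by rewrite expr_le1//; exact: sqnorm_ge0.
Qed.

(** Rounding each coordinate towards 0 keeps the vector in the unit ball; each of the [N] squared
    errors is at most [1 / (16 N)]. *)
Lemma lattice_round x : (0 < N)%N -> sqnorm x <= 1 -> exists b a,
  (\sum_i a i ^ 2 <= 16 * N)%N /\ sqnorm (fun i => x i - lattice_vec b a i) <= 16^-1.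
Proof.
move=> N0 hx; have N0R : 0 < N%:R :> R by rewrite ltr0n.
set q := 4 * Num.sqrt N%:R : R.
have q0 : 0 < q by rewrite mulr_gt0// sqrtr_gt0.
have q2 : q ^+ 2 = 16 * N%:R by rewrite exprMn sqr_sqrtr ?ltW//; congr (_ * _); ring.
pose a i := Num.trunc (q * `|x i|).
pose b i := x i < 0.
have aP i : (a i)%:R <= q * `|x i| < (a i)%:R + 1.
  by rewrite natr1; apply: truncn_itv; rewrite mulr_ge0// ltW.
exists b, a; split.
  rewrite -(ler_nat R) natr_sum natrM -q2 -[leRHS]mulr1.
  apply: (@le_trans _ _ (q ^+ 2 * sqnorm x)); last by rewrite ler_wpM2l ?sqr_ge0.
  rewrite /sqnorm mulr_sumr; apply: ler_sum => i _.
  have /andP[h _] := aP i.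
  by rewrite natrX -(real_normK (num_real (x i))) -exprMn lerXn2r ?nnegrE ?mulr_ge0 ?(ltW q0).
apply: (@le_trans _ _ (\sum_(i < N) (q ^+ 2)^-1)); last first.
  rewrite sumr_const card_ord q2 -mulr_natl le_eqVlt; apply/orP; left; apply/eqP.
  by field; rewrite gt_eqF.
apply: ler_sum => i _; rewrite /lattice_vec -/q.
rewrite -(ler_pM2l (exprn_gt0 2 q0)) mulfV ?gt_eqF ?exprn_gt0// -exprMn mulrBr.
rewrite [q * (_ / q)]mulrC divfK ?gt_eqF//.
have /andP[h1 h2] := aP i; rewrite /b; case: (ltrP (x i) 0) => xi.
  rewrite ltr0_norm// in h1 h2; rewrite expr1 -sqrrN.
  have : 0 <= - (q * x i - -1 * (a i)%:R) < 1 by apply/andP; split; lra.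
  by move=> /andP[? ?]; rewrite expr_le1// ltW.
rewrite ger0_norm// in h1 h2; rewrite expr0 mul1r.
have : 0 <= q * x i - (a i)%:R < 1 by apply/andP; split; lra.
by move=> /andP[? ?]; rewrite expr_le1// ltW.
Qed.

Lemma bilin_le_sqnorm r : (forall x, sqnorm x <= 1 -> `|bilin M x x| <= r) ->
  forall u v, `|bilin M u v| <= r * (sqnorm u + sqnorm v) / 2.
Proof.
move=> hr.
have hQ x : `|bilin M x x| <= r * sqnorm x.
  case: (lerP (sqnorm x) 0) => [x1|x0].
    have x0 : sqnorm x = 0 by apply/eqP; rewrite eq_le x1 sqnorm_ge0.
    have xi i : x i = 0.
      apply/eqP; rewrite -(sqrf_eq0 (x i)); apply/eqP; apply: (psumr_eq0P _ x0) => //.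
      by move=> j _; exact: sqr_ge0.
    rewrite /bilin big1 ?normr0 ?x0 ?mulr0// => i _.
    by rewrite big1// => j _; rewrite xi mul0r mulr0.
  pose c := (Num.sqrt (sqnorm x))^-1.
  have c2 : c ^+ 2 * sqnorm x = 1.
    by rewrite exprVn sqr_sqrtr ?mulVf ?gt_eqF// ltW.
  have c0 : 0 < c ^+ 2 by rewrite exprn_gt0// invr_gt0 sqrtr_gt0.
  have := hr (fun i => c * x i); rewrite sqnormZ c2 bilinZZ => /(_ (lexx _)).
  rewrite normrM (ger0_norm (ltW c0)) => h.
  by rewrite -(ler_pM2l c0) mulrCA c2 mulr1.
move=> u v.
have h1 := hQ (fun i => u i + v i); have h2 := hQ (fun i => u i - v i).
have h3 := bilin_polar u v; have h4 := sqnorm_par u v.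
set P := bilin M _ _ in h1 h3; set Q := bilin M _ _ in h2 h3.
set p := sqnorm _ in h1 h4; set q := sqnorm _ in h2 h4.
have h5 : `|4 * bilin M u v| <= r * (2 * (sqnorm u + sqnorm v)).
  by rewrite -h3 -h4 mulrDr; apply: le_trans (ler_normB _ _) _; exact: lerD.
rewrite normrM (ger0_norm (_ : 0 <= 4)) // in h5.
by rewrite mulrC; lra.
Qed.

(** Self-bounding: with [r] the supremum of the form over the ball, rounding [x] to [y] changes the
    form by at most [r / 2], so [r <= s + r / 2]. The crude entrywise bound makes [r] a genuine
    supremum. *)
Lemma bilin_le_lattice s : (0 < N)%N ->
  (forall b a, (\sum_i a i ^ 2 <= 16 * N)%N ->
     `|bilin M (lattice_vec b a) (lattice_vec b a)| <= s) ->
  forall x, sqnorm x <= 1 -> `|bilin M x x| <= 2 * s.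
Proof.
move=> N0 hs.
pose E := [set `|bilin M x x| | x in [set x | sqnorm x <= 1]]%classic.
have supE : has_sup E.
  split.
    exists `|bilin M (fun=> 0) (fun=> 0)|; exists (fun=> 0) => //=.
    by rewrite /sqnorm big1// => i _; rewrite expr0n.
  exists (\sum_i \sum_j `|M i j|) => _ [x /= hx <-].
  apply: le_trans (ler_norm_sum _ _ _) _; apply: ler_sum => i _.
  apply: le_trans (ler_norm_sum _ _ _) _; apply: ler_sum => j _.
  rewrite normrM ler_piMr// normrM mulr_ile1//; exact: sqnorm_coord.
pose r := sup E.
have hr x : sqnorm x <= 1 -> `|bilin M x x| <= r.
  by move=> hx; apply: sup_upper_bound => //; exists x.
suff r2s : r <= 2 * s by move=> x /hr h; exact: le_trans h r2s.
suff : r <= s + r / 2 by lra.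
apply: ge_sup; first by case: supE.
move=> _ [x /= hx <-].
have [b [a [ha hy]]] := lattice_round N0 hx.
set y := lattice_vec b a in hy.
have hsy := hs b a ha; rewrite -/y in hsy.
have ny : sqnorm y <= 1 by exact: sqnorm_lattice.
have := bilin_diff_sq x y.
set z := (fun i => x i - y i) in hy *; set w := (fun i => x i + y i) => hd.
have nw : sqnorm w <= 4.
  have := sqnorm_par x y; rewrite -/z -/w; have := sqnorm_ge0 z; lra.
have r0 : 0 <= r by exact: le_trans (hr _ hx).
(* The factor 8 balances the two arguments: both squared norms are then at most 4. *)
have := bilin_le_sqnorm hr (fun i => 8 * z i) w.
rewrite bilinZ sqnormZ normrM (ger0_norm (_ : 0 <= 8))// => h8.
have h9 : r * (8 ^+ 2 * sqnorm z + sqnorm w) <= r * 8.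
  by rewrite ler_wpM2l//; lra.
have h10 : `|bilin M z w| <= r / 2 by lra.
have -> : bilin M x x = bilin M y y + bilin M z w by rewrite -hd; ring.
by apply: le_trans (ler_normD _ _) _; exact: lerD.
Qed.

(** For [v = M x] of norm [n], the bilinear form at [v / n] and [x] equals [n], and polarization
    bounds it by [s]. *)
Lemma spectral_norm_le s : (forall x, sqnorm x <= 1 -> `|bilin M x x| <= s) ->
  spectral_norm M <= s.
Proof.
move=> hs; apply: ge_sup.
  exists (norm2 (M *m 0)); exists 0 => //=.
  by rewrite /norm2 big1 ?sqrtr0// => i _; rewrite mxE expr0n.
move=> _ [X /= hX <-].
pose x i := X i 0; pose v i := (M *m X) i 0.
have nx : sqnorm x <= 1.
  rewrite -(sqr_sqrtr (sqnorm_ge0 x)) expr_le1//; exact: sqrtr_ge0.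
set n := norm2 _; have n2 : n ^+ 2 = sqnorm v by rewrite sqr_sqrtr// sqnorm_ge0.
have n0 : 0 <= n by exact: sqrtr_ge0.
have hv : bilin M v x = sqnorm v.
  rewrite /bilin /sqnorm; apply: eq_bigr => i _.
  rewrite expr2 {2}/v mxE mulr_suml; apply: eq_bigr => j _.
  by rewrite /x; ring.
have s0 : 0 <= s.
  by apply: le_trans (hs (fun=> 0) _); rewrite ?normr_ge0// /sqnorm big1// => i _; rewrite expr0n.
case: (lerP n 0) => [n1|n1]; first exact: le_trans s0.
have := bilin_le_sqnorm hs (fun i => n^-1 * v i) x.
rewrite bilinZ sqnormZ hv -n2 exprVn mulVf ?gt_eqF ?exprn_gt0//.
rewrite expr2 mulrA mulVf ?gt_eqF// mul1r ger0_norm// => h.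
have : s * (1 + sqnorm x) <= s * 2 by rewrite ler_wpM2l//; lra.
lra.
Qed.

End QuadraticForms.

(** * Exponential moments of random sets of hyperedges *)

Section RandomSubset.
Context {R : realType} (T : finType).
Variables (p : {set T} -> R) (V : {set T}) (q : T -> R).
Hypothesis p_ge0 : forall h, 0 <= p h.
Hypothesis p_supp : forall h : {set T}, ~~ (h \subset V) -> p h = 0.
Hypothesis p_sup : forall F : {set T}, F \subset V ->
  \sum_(h : {set T} | F \subset h) p h = \prod_(e in F) q e.
Hypothesis q01 : forall e, e \in V -> 0 <= q e <= 1.
Implicit Types (w : T -> R) (h : {set T}).

Lemma law_sum1 : \sum_h p h = 1.
Proof.
have := p_sup (finset.sub0set V); rewrite big_set0 => <-.
by apply: eq_bigl => h; rewrite finset.sub0set.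
Qed.

Lemma law_mean w : \sum_h p h * \sum_(e in h) w e = \sum_(e in V) q e * w e.
Proof.
under eq_bigr => h _ do rewrite mulr_sumr big_mkcond.
rewrite exchange_big [RHS]big_mkcond; apply: eq_bigr => e _ /=.
case: ifPn => eV; last first.
  apply: big1 => h _; case: ifPn => // eh; rewrite p_supp ?mul0r//.
  by apply: contra eV => /fintype.subsetP/(_ _ eh).
rewrite -big_mkcond -mulr_suml; congr (_ * _).
have := @p_sup [set e]%SET; rewrite finset.sub1set big_set1 => /(_ eV) <-.
by apply: eq_bigl => h; rewrite finset.sub1set.
Qed.

(** The exponential is expanded as a sum over subsets [J] of [h] of products of [expR (w e) - 1].
    Averaging over [h] then meets the law only through the probabilities of containing [J], which is
    the form in which independence is given; the result refolds into a product of factors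
    [1 + q e * (expR (w e) - 1)]. *)
Lemma law_exp_moment w :
  \sum_h p h * expR (\sum_(e in h) w e)
  <= expR (\sum_(e in V) q e * (expR (w e) - 1)).
Proof.
pose c e := if e \in V then expR (w e) - 1 else 0.
have step1 (h : {set T}) : p h * expR (\sum_(e in h) w e)
    = p h * \sum_(J : {set T} | J \subset h) \prod_(e in J) c e.
  have [hV|hV] := boolP (h \subset V); last by rewrite p_supp// !mul0r.
  congr (_ * _); rewrite expR_sum.
  transitivity (\prod_e ((if e \in h then c e else 0) + 1)).
    rewrite big_mkcond; apply: eq_bigr => e _.
    by case: ifP => [eh|_]; rewrite ?add0r// /c (fintype.subsetP hV)// subrK.
  rewrite bigA_distr [RHS]big_mkcond; apply: eq_bigr => J _.
  case: ifPn => [Jh|]; rewrite -big_mkcond/=.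
    by apply: eq_bigr => e eJ; rewrite (fintype.subsetP Jh).
  move=> /fintype.subsetPn[e eJ eh].
  by rewrite (bigD1 e)//= (negbTE eh) mul0r.
under eq_bigr => h _ do rewrite step1 mulr_sumr big_mkcond.
rewrite exchange_big/=.
rewrite (eq_bigr (fun J : {set T} => \prod_e if e \in J then c e * q e else 1)); last first.
  move=> J _; rewrite -big_mkcond -mulr_suml -big_mkcond big_split/=.
  have [JV|/fintype.subsetPn[e eJ eV]] := boolP (J \subset V).
    by rewrite p_sup// mulrC.
  by rewrite (bigD1 e)//= /c (negbTE eV) !mul0r mulr0.
rewrite -(bigA_distr _ _ (fun e => c e * q e) (fun=> 1)).
apply: (@le_trans _ _ (\prod_e expR (c e * q e))).
  apply: ler_prod => e _ /=; rewrite addrC expR_ge1Dx andbT /c.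
  case: ifPn => [/q01/andP[q0 q1]|_]; last by rewrite mul0r addr0.
  have := expR_gt0 (w e); nra.
rewrite -expR_sum ler_expR [leRHS]big_mkcond; apply: ler_sum => e _.
by rewrite /c; case: ifP => _; rewrite ?mul0r// mulrC.
Qed.

Lemma law_chernoff w t :
  \sum_(h : {set T} | t <= \sum_(e in h) w e) p h
  <= expR (\sum_(e in V) q e * (expR (w e) - 1) - t).
Proof.
rewrite expRD expRN ler_pdivlMr ?expR_gt0//.
apply: le_trans (law_exp_moment w).
rewrite mulr_suml big_mkcond; apply: ler_sum => h _.
case: ifP => [ht|_]; first by rewrite ler_wpM2l// ler_expR.
by rewrite mulr_ge0// expR_ge0.
Qed.

Lemma law_bernstein w t : (forall e, e \in V -> `|w e| <= 2^-1) ->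
  \sum_(h : {set T} | t <= \sum_(e in h) w e - \sum_(e in V) q e * w e) p h
  <= expR (2 * (\sum_(e in V) q e * w e ^+ 2) - t).
Proof.
move=> hw; set m := \sum_(e in V) q e * w e.
under eq_bigl => h do rewrite lerBrDr.
apply: (le_trans (law_chernoff w _)); rewrite ler_expR.
suff : \sum_(e in V) q e * (expR (w e) - 1)
    <= m + 2 * \sum_(e in V) q e * w e ^+ 2 by lra.
rewrite /m mulr_sumr -big_split; apply: ler_sum => e eV /=.
have /andP[q0 _] := q01 eV.
rewrite [leRHS](_ : _ = q e * (w e + 2 * w e ^+ 2)); last by ring.
by rewrite ler_wpM2l//; have := expR_le_quad (hw e eV); lra.
Qed.

(** For weights in the unit interval the secant bound linearizes the exponent in [w], leaving the
    exponential moment of a Poisson variable of the same mean. *)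
Lemma law_poisson w s t : (forall e, e \in V -> 0 <= w e <= 1) ->
  \sum_(h : {set T} | t <= s * \sum_(e in h) w e) p h
  <= expR ((expR s - 1) * (\sum_(e in V) q e * w e) - t).
Proof.
move=> hw.
under eq_bigl => h do rewrite mulr_sumr.
apply: (le_trans (law_chernoff _ _)); rewrite ler_expR lerD2r mulr_sumr.
apply: ler_sum => e eV; have /andP[q0 _] := q01 eV.
rewrite [leRHS](_ : _ = q e * (w e * (expR s - 1))); last by ring.
by rewrite ler_wpM2l//; have := expR_secant s (hw e eV); rewrite mulrC; lra.
Qed.

End RandomSubset.

(** * Weights and expected weights of hyperedges *)

Section EdgePairs.
Context {R : realType} (N : nat).
Implicit Types (e : {set 'I_N}) (h : {set {set 'I_N}}) (g : 'I_N -> 'I_N -> R).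

Definition edge_pairs e : {set 'I_N * 'I_N} :=
  [set x | [&& x.1 \in e, x.2 \in e & x.1 != x.2]]%SET.

Definition edge_weight g e : R := \sum_(x in edge_pairs e) g x.1 x.2.

Lemma card_edge_pairs e : #|edge_pairs e| = (#|e| * #|e|.-1)%N.
Proof.
have -> : edge_pairs e = (finset.setX e e :\: [set (i, i) | i in e])%SET.
  apply/finset.setP => -[i j]; rewrite !inE/=.
  have -> : ((i, j) \in [set (k, k) | k in e]%SET) = (i \in e) && (i == j).
    apply/imsetP/andP => [[k ke [-> ->]]|[ie /eqP <-]]; first by rewrite ke eqxx.
    by exists i.
  by case: (i \in e); case: (j \in e); rewrite //= ?andbT ?andbF.
rewrite cardsD cardsX.
have /finset.setIidPr -> : [set (i, i) | i in e]%SET \subset finset.setX e e.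
  by apply/fintype.subsetP => x /imsetP[i ie ->]; rewrite inE /= ie.
by rewrite card_imset => [|i j [->]//]; rewrite -[X in (_ - X)%N]muln1 -mulnBr subn1.
Qed.

(** Passage from the dependent entries of the matrix to a sum over the independent hyperedges, to
    which the exponential moment bounds apply. *)
Lemma adjacency_sum h g :
  \sum_i \sum_j adjacency R h i j * g i j = \sum_(e in h) edge_weight g e.
Proof.
rewrite pair_bigA/= /edge_weight.
under [RHS]eq_bigr => e _ do rewrite big_mkcond.
rewrite exchange_big/=; apply: eq_bigr => -[i j] _; rewrite mxE/=.
case: eqVneq => [->|ij].
  by rewrite mul0r big1// => e _; rewrite inE/= eqxx !andbF.
rewrite -big_mkcondr/= -sum1_card natr_sum mulr_suml.
by apply: eq_big => e; [rewrite !inE/= ij andbT|rewrite mul1r].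
Qed.

Lemma edge_weight_norm g b e : (forall i j, `|g i j| <= b) ->
  `|edge_weight g e| <= (#|e| * #|e|.-1)%:R * b.
Proof.
move=> hb; apply: le_trans (ler_norm_sum _ _ _) _.
apply: (@le_trans _ _ (\sum_(x in edge_pairs e) b)); first exact: ler_sum.
by rewrite sumr_const card_edge_pairs mulr_natl.
Qed.

Lemma edge_weight_ge0 g e : (forall i j, 0 <= g i j) -> 0 <= edge_weight g e.
Proof. by move=> g0; exact: sumr_ge0. Qed.

Lemma edge_weight_sq g e : edge_weight g e ^+ 2 <=
  (#|e| * #|e|.-1)%:R * edge_weight (fun i j => g i j ^+ 2) e.
Proof.
rewrite /edge_weight -card_edge_pairs; set D := edge_pairs e.
apply: (@le_trans _ _ (\sum_(x in D) \sum_(y in D)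
    (2^-1 * g x.1 x.2 ^+ 2 + 2^-1 * g y.1 y.2 ^+ 2))).
  rewrite expr2 mulr_suml; apply: ler_sum => x _.
  rewrite mulr_sumr; apply: ler_sum => y _.
  by have := sqr_ge0 (g x.1 x.2 - g y.1 y.2); lra.
under eq_bigr => x _ do rewrite big_split/= sumr_const -mulr_sumr.
rewrite big_split/= sumr_const sumrMnl -mulr_sumr -[X in X + _]mulr_natl -[X in _ + X]mulr_natl.
by rewrite le_eqVlt; apply/orP; left; apply/eqP; field.
Qed.

End EdgePairs.

Section MeanDegree.
Context {R : realType} (N : nat) (LL : {fset nat}) (dt : {set 'I_N} -> R).
Hypothesis LL_ge2 : forall l : nat, l \in LL -> (2 <= l)%N.

Local Notation PE := (possible_edges N LL).

(** Removing [i] and [j] is injective on these sets and lands in the [l - 2]-subsets of the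
    complement. *)
Lemma card_sets_through2 (i j : 'I_N) l : i != j -> (2 <= l)%N ->
  (#|[set e : {set 'I_N} | [&& #|e| == l, i \in e & j \in e]]%SET| <= 'C(N.-2, l.-2))%N.
Proof.
move=> ij l2; pose U := [set i; j]%SET.
have U2 : #|U| = 2 by rewrite cards2 ij.
have cU : #|~: U| = N.-2 by rewrite cardsCs finset.setCK card_ord U2 subn2.
rewrite -cU -cards_draws.
rewrite -(@card_in_imset _ _ (fun e : {set 'I_N} => (e :\: U)%SET)) => [|e f]; last first.
  rewrite !inE => /and3P[_ ie je] /and3P[_ jf kf] h.
  have sub (k : {set 'I_N}) : i \in k -> j \in k -> (k :&: U)%SET = U.
    move=> ik jk; apply/finset.setIidPr; apply/fintype.subsetP => x.
    by rewrite !inE => /orP[]/eqP->.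
  by rewrite -[LHS](finset.setID e U) -[RHS](finset.setID f U) /= h !sub.
apply: subset_leq_card; apply/fintype.subsetP => B /imsetP[e].
rewrite !inE => /and3P[/eqP el ie je] ->; rewrite subsetDr/= finset.cardsD el.
have /finset.setIidPr -> : U \subset e.
  by apply/fintype.subsetP => x; rewrite !inE => /orP[]/eqP->.
by rewrite U2 subn2.
Qed.

Lemma dmax_ge0 l : 0 <= dmax dt l.
Proof. exact: bigmax_ge_id. Qed.

Lemma dtot_ge0 : 0 <= dtot LL dt.
Proof. by apply: sumr_ge0 => l _; rewrite mulr_ge0// dmax_ge0. Qed.

(** The ratio of ['C(N - 2, l - 2)] to ['C(N - 1, l - 1)] is [(l - 1) / (N - 1)], whence the weight
    [l - 1] of each order in [dtot]. *)
Lemma pair_mean_le (i j : 'I_N) : i != j ->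
  \sum_(e in PE | (i \in e) && (j \in e)) edge_prob dt e <= dtot LL dt / N.-1%:R.
Proof.
move=> ij.
have N2 : (2 <= N)%N.
  have : (#|[set i; j]%SET| <= N)%N by rewrite -[leqRHS]card_ord max_card.
  by rewrite cards2 ij.
have -> : \sum_(e in PE | (i \in e) && (j \in e)) edge_prob dt e
    = \sum_(l <- LL) \sum_(e : {set 'I_N} | [&& #|e| == l, i \in e & j \in e]) edge_prob dt e.
  under [RHS]eq_bigr => l _ do rewrite big_mkcond.
  rewrite exchange_big big_mkcond; apply: eq_bigr => e _ /=.
  rewrite !inE; case: (boolP (_ && _)) => [/and3P[eL ie je]|].
    under eq_bigr => l _ do rewrite ie je !andbT eq_sym.
    by rewrite -big_mkcond -big_filter filter_pred1_uniq ?fset_uniq// big_seq1.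
  move=> h; rewrite big_seq big1// => l lL; case: ifP => // /and3P[/eqP el ie je].
  by move: h; rewrite el lL ie je.
rewrite /dtot mulr_suml big_seq [leRHS]big_seq; apply: ler_sum => l lL.
have l2 := LL_ge2 lL.
apply: (@le_trans _ _ ('C(N.-2, l.-2)%:R * (dmax dt l / 'C(N.-1, l.-1)%:R))).
  apply: (@le_trans _ _ (\sum_(e : {set 'I_N} | [&& #|e| == l, i \in e & j \in e])
      (dmax dt l / 'C(N.-1, l.-1)%:R))).
    apply: ler_sum => e /and3P[/eqP el _ _]; rewrite /edge_prob el.
    rewrite ler_wpM2r// ?invr_ge0//; apply: le_bigmax_cond; exact/eqP.
  rewrite sumr_const -[leLHS]mulr_natl ler_wpM2r ?divr_ge0 ?dmax_ge0//.
  rewrite ler_nat; apply: leq_trans (card_sets_through2 ij l2).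
  by rewrite cardsE.
have := mul_bin_diag N.-1 l.-2; rewrite (_ : l.-2.+1 = l.-1); last by case: l l2 {lL} => [|[]].
move=> hb.
have N1 : 0 < N.-1%:R :> R by rewrite ltr0n; case: (N) N2 => [|[]].
(* The binomial vanishes when [l > N]; its inverse is then 0 by convention. *)
have [c0|c0] := posnP 'C(N.-1, l.-1).
  by rewrite c0 invr0 !mulr0 divr_ge0// mulr_ge0// dmax_ge0.
have {}c0 : 0 < 'C(N.-1, l.-1)%:R :> R by rewrite ltr0n.
have {}hb : N.-1%:R * 'C(N.-2, l.-2)%:R = l.-1%:R * 'C(N.-1, l.-1)%:R :> R.
  by rewrite -!natrM hb.
rewrite le_eqVlt; apply/orP; left; apply/eqP.
apply: (mulfI (lt0r_neq0 N1)); apply: (mulIf (lt0r_neq0 c0)).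
transitivity (dmax dt l * (N.-1%:R * 'C(N.-2, l.-2)%:R)).
  by field; rewrite gt_eqF.
by rewrite hb; field; rewrite gt_eqF.
Qed.

(** The factor [3 / 2] pays for replacing [N - 1] by [N], which is possible exactly from [N = 3]
    on. *)
Lemma mean_edge_weight g : (3 <= N)%N -> (forall i j, 0 <= g i j) ->
  \sum_(e in PE) edge_prob dt e * edge_weight g e
  <= 3 / 2 * (dtot LL dt / N%:R) * \sum_i \sum_j g i j.
Proof.
move=> N3 g0; rewrite /edge_weight pair_bigA mulr_sumr/=.
under eq_bigr => e _ do rewrite mulr_sumr big_mkcond.
rewrite exchange_big; apply: ler_sum => -[i j] _ /=.
case: (eqVneq i j) => [->|ij].
  rewrite big1 => [|e _]; last by rewrite inE/= eqxx !andbF.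
  rewrite mulr_ge0// mulr_ge0 ?divr_ge0 ?dtot_ge0//.
rewrite -big_mkcondr/= -mulr_suml ler_wpM2r//.
rewrite (eq_bigl (fun e => (e \in PE) && ((i \in e) && (j \in e)))) => [|e]; last first.
  by rewrite !inE/= ij andbT.
apply: (le_trans (pair_mean_le ij)).
have N1 : 0 < N.-1%:R :> R by rewrite ltr0n; case: (N) N3 => [|[]].
have N1E : N.-1%:R = N%:R - 1 :> R by case: (N) N3 => // n _; rewrite -natr1 addrK.
have N3R : 3 <= N%:R :> R by rewrite ler_nat.
have d0 := dtot_ge0.
rewrite [leRHS](_ : _ = dtot LL dt * (3 / (2 * N%:R))); last first.
  by field; rewrite gt_eqF//; lra.
rewrite ler_wpM2l// N1E.
have n1 : 0 < N%:R - 1 :> R by lra.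
rewrite -(ler_pM2l n1) mulfV ?gt_eqF//.
have n0 : 0 < 2 * N%:R :> R by lra.
rewrite mulrA ler_pdivlMr//; lra.
Qed.

End MeanDegree.

(** * Cardinality of the net and of the family of blocks *)

Section Counting.
Context {R : realType} (N : nat).
Hypothesis N_gt0 : (0 < N)%N.

Let N_gt0R : 0 < N%:R :> R. Proof. by rewrite ltr0n. Qed.

(** The bound [4 N] on the numerators loses no vector, as [a i ^ 2 <= 16 N <= (4 N) ^ 2]. *)
Definition lattice_net : {set {ffun 'I_N -> bool} * {ffun 'I_N -> 'I_(4 * N).+1}} :=
  [set z : {ffun 'I_N -> bool} * {ffun 'I_N -> 'I_(4 * N).+1}
     | (\sum_i (z.2 i : nat) ^ 2 <= 16 * N)%N]%SET.

(* AM-GM gives [sum a_i <= 4 N] on the net, so each [a] has weight at least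
   [16 ^- N] under the product of the weights [2 ^- a_i]. *)
Lemma card_lattice_net : #|lattice_net|%:R <= 64 ^+ N :> R.
Proof.
rewrite -sum1_card natr_sum.
have h2 : 2^-1 != 0 :> R by rewrite invr_eq0.
apply: (@le_trans _ _ (\sum_(z : {ffun 'I_N -> bool} * {ffun 'I_N -> 'I_(4 * N).+1})
    16 ^+ N * \prod_i (2^-1 ^+ z.2 i))).
  rewrite big_mkcond; apply: ler_sum => z _; case: ifP => [|_]; last first.
    by rewrite mulr_ge0 ?exprn_ge0// prodr_ge0.
  rewrite inE => hz.
  have hs : (\sum_i (z.2 i : nat) <= 4 * N)%N.
    rewrite -(@leq_pmul2l 8)// big_distrr/=.
    apply: (@leq_trans (\sum_i ((z.2 i : nat) ^ 2 + 16))).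
      apply: leq_sum => i _; rewrite mulnC -[8%N]/(4 * 2)%N mulnA mulnC.
      exact: (nat_Cauchy _ 4).1.
    rewrite big_split/= sum_nat_const card_ord [(N * 16)%N]mulnC.
    by rewrite (leq_trans (leq_add hz (leqnn _)))// -mulnDl mulnA.
  rewrite prodrXr (_ : 16 = 2 ^+ 4 :> R); last by ring.
  rewrite -exprM exprVn ler_pdivlMr ?exprn_gt0// mul1r ler_eXn2l//; last by lra.
rewrite -mulr_sumr.
(* The factor 4 per coordinate is two signs times a geometric sum of ratio [1 / 2]. *)
rewrite (_ : 64 = 16 * 4 :> R); last by ring.
rewrite exprMn ler_wpM2l ?exprn_ge0//.
rewrite -(pair_bigA _ (fun (b : {ffun 'I_N -> bool}) (a : {ffun 'I_N -> 'I_(4 * N).+1}) =>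
  \prod_i (2^-1 ^+ a i : R)))/=.
rewrite sumr_const card_ffun card_bool card_ord -(bigA_distr_bigA (fun i k => 2^-1 ^+ (k : 'I__))).
rewrite prodr_const card_ord -[leLHS]mulr_natl natrX -exprMn.
rewrite lerXn2r ?nnegrE ?mulr_ge0 ?sumr_ge0//.
have := @sum_geo_le R 2^-1 (4 * N).+1 ltac:(apply/andP; split; lra).
by rewrite (_ : (1 - 2^-1)^-1 = 2 :> R); [lra|field].
Qed.

(* Weight each set [S] by [x ^ #|S|] with [x = #|T| / N <= 1]. *)
Lemma card_small_sets (T : {set 'I_N}) : (0 < #|T|)%N ->
  #|[set S : {set 'I_N} | (#|S| <= #|T|)%N]%SET|%:R <= expR (#|T|%:R * log_card T) :> R.
Proof.
move=> T0; set t := #|T| in T0 *.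
have t0 : 0 < t%:R :> R by rewrite ltr0n.
have tN : t%:R <= N%:R :> R by rewrite ler_nat -[leqRHS]card_ord max_card.
rewrite /log_card -/t mulrDr mulr1 expRD expRM_natl lnK ?posrE ?divr_gt0//.
rewrite -ler_pdivrMr ?exprn_gt0 ?divr_gt0// -exprVn invf_div.
have x01 : 0 <= (t%:R / N%:R : R) <= 1.
  by rewrite divr_ge0//= ler_pdivrMr// mul1r.
set x : R := t%:R / N%:R in x01 *; have /andP[x0 x1] := x01.
apply: (@le_trans _ _ (\sum_(S : {set 'I_N}) x ^+ #|S|)).
  rewrite -sum1_card natr_sum mulr_suml big_mkcond; apply: ler_sum => S _.
  case: ifP => [|_]; last exact: exprn_ge0.
  by rewrite inE mul1r => h; exact: ler_wiXn2l.
rewrite (eq_bigr (fun S : {set 'I_N} => \prod_i (if i \in S then x else 1))); last first.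
  by move=> S _; rewrite -big_mkcond prodr_const.
rewrite -(bigA_distr _ _ (fun=> x) (fun=> 1)) prodr_const card_ord.
have -> : expR t%:R = expR x ^+ N.
  by rewrite -expRM_natl /x; congr expR; field; rewrite gt_eqF.
by rewrite lerXn2r ?nnegrE ?expR_ge0 ?addr_ge0//= addrC expR_ge1Dx.
Qed.

(** Monotonicity of [t * (1 + ln (N / t))] on [[1, N]], obtained from
    [(t - 1) * ln t <= (t - 1) * ln N] and [ln t <= t - 1]. *)
Lemma card_log_card_ge (T : {set 'I_N}) : (0 < #|T|)%N ->
  1 + ln N%:R <= #|T|%:R * log_card T :> R.
Proof.
move=> T0; set t : R := #|T|%:R.
have t0 : 0 < t by rewrite ltr0n.
have t1 : 1 <= t by rewrite ler1n.
have tN : t <= N%:R by rewrite ler_nat -[leqRHS]card_ord max_card.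
rewrite /log_card -/t ln_div ?posrE//.
have h1 : ln t <= ln N%:R by rewrite ler_ln ?posrE.
have h2 := ln_le_subr1 t0.
nra.
Qed.

(** In the exponent [theta + 4], one unit pays for [S], one for [T] of given cardinality, and one,
    worth at least [e * N], for the at most [N] cardinalities and the factor [2 <= e]. What remains
    exceeds [theta]. *)
Lemma sum_discrepancy_tail theta : 0 <= theta ->
  \sum_(T : {set 'I_N} | (0 < #|T|)%N) \sum_(S : {set 'I_N} | (#|S| <= #|T|)%N)
     2 * expR (- ((theta + 4) * (#|T|%:R * log_card T)))
  <= N%:R `^ (- theta) :> R.
Proof.
move=> th0; pose y (t : nat) : R := t%:R * (1 + ln (N%:R / t%:R)).
have yE (T : {set 'I_N}) : y #|T| = #|T|%:R * log_card T by [].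
have cnt (T : {set 'I_N}) : (0 < #|T|)%N ->
    #|[set S : {set 'I_N} | (#|S| <= #|T|)%N]%SET|%:R <= expR (y #|T|).
  exact: card_small_sets.
apply: (@le_trans _ _ (\sum_(T : {set 'I_N} | (0 < #|T|)%N)
    2 * expR (- ((theta + 3) * y #|T|)))).
  apply: ler_sum => T T0; rewrite -yE sumr_const -[leLHS]mulr_natl.
  rewrite [leRHS](_ : _ = expR (y #|T|) * (2 * expR (- ((theta + 4) * y #|T|)))).
    by rewrite ler_wpM2r ?mulr_ge0 ?expR_ge0//; have := cnt T T0; rewrite cardsE.
  by rewrite [RHS]mulrCA -expRD; congr (_ * expR _); ring.
rewrite (partition_big (fun T : {set 'I_N} => inord #|T| : 'I_N.+1) (fun t => (0 < t)%N)) => [|T T0]; last first.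
  by rewrite inordK// ltnS -[leqRHS]card_ord max_card.
apply: (@le_trans _ _ (\sum_(t < N.+1 | (0 < t)%N) 2 * expR (- ((theta + 2) * (1 + ln N%:R))))).
  apply: ler_sum => t t0.
  have [T0 T0t] : exists T0 : {set 'I_N}, #|T0| = t.
    have : (0 < #|[set A : {set 'I_N} | #|A| == t]%SET|)%N.
      by rewrite card_draws card_ord bin_gt0 -ltnS.
    by move=> /card_gt0P[A]; rewrite inE => /eqP; exists A.
  have T00 : (0 < #|T0|)%N by rewrite T0t.
  apply: (@le_trans _ _ (\sum_(T in [set S : {set 'I_N} | (#|S| <= #|T0|)%N]%SET)
       2 * expR (- ((theta + 3) * y t)))).
    rewrite big_mkcond [leRHS]big_mkcond; apply: ler_sum => T _.
    have e0 : 0 <= 2 * expR (- ((theta + 3) * y t)) by rewrite mulr_ge0 ?expR_ge0.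
    case: ifP => [/andP[_ /eqP h]|_]; last by case: ifP.
    have Tt : #|T| = t by rewrite -h inordK// ltnS -[leqRHS]card_ord max_card.
    by rewrite inE Tt T0t leqnn.
  rewrite sumr_const -[leLHS]mulr_natl.
  have yt := card_log_card_ge T00; rewrite -yE T0t in yt.
  apply: (@le_trans _ _ (expR (y t) * (2 * expR (- ((theta + 3) * y t))))).
    by rewrite ler_wpM2r ?mulr_ge0 ?expR_ge0// -[in y t]T0t; exact: cnt.
  rewrite mulrCA -expRD ler_pM2l// ler_expR.
  have : (theta + 2) * (1 + ln N%:R) <= (theta + 2) * y t by rewrite ler_wpM2l//; lra.
  lra.
have lnN : 0 <= ln N%:R :> R by rewrite ln_ge0// ler1n.
apply: (@le_trans _ _ (N%:R * (2 * expR (- ((theta + 2) * (1 + ln N%:R)))))).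
  rewrite sumr_const -[leLHS]mulr_natl ler_wpM2r ?mulr_ge0 ?expR_ge0// ler_nat.
  apply: (@leq_trans #|[set~ (ord0 : 'I_N.+1)]%SET|); last by rewrite cardsC1 card_ord.
  by apply: subset_leq_card; apply/fintype.subsetP => t t0; rewrite !inE -val_eqE/= -lt0n.
rewrite /powR gt_eqF// -[X in X * _ <= _]lnK ?posrE// mulrCA -expRD.
have h2 : 2 <= expR 1 :> R by have /andP[] := @expR1_bounds R.
apply: (le_trans (ler_wpM2r (expR_ge0 _) h2)).
rewrite -expRD ler_expR; nra.
Qed.

End Counting.

(** * Probabilities of the two bad events *)

Section LawUnion.
Context {R : realType} (T Z : finType) (p : T -> R).
Hypothesis p_ge0 : forall h, 0 <= p h.

Lemma law_union (D : pred Z) (B : Z -> pred T) :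
  \sum_(h | [exists z, D z && B z h]) p h <= \sum_(z | D z) \sum_(h | B z h) p h.
Proof.
under [leRHS]eq_bigr => z _ do rewrite big_mkcond.
rewrite exchange_big big_mkcond; apply: ler_sum => h _ /=.
case: ifPn => [/existsP[z /andP[Dz Bz]]|_].
  rewrite (bigD1 z)//= Bz lerDl; apply: sumr_ge0 => k _; by case: ifP.
by apply: sumr_ge0 => z _; case: ifP.
Qed.

Lemma law_or (A B : pred T) :
  \sum_(h | A h || B h) p h <= \sum_(h | A h) p h + \sum_(h | B h) p h.
Proof.
rewrite big_mkcond [X in _ <= X + _]big_mkcond [X in _ <= _ + X]big_mkcond -big_split.
by apply: ler_sum => h _ /=; case: (A h); case: (B h); rewrite ?(addr0, add0r)// lerDl.
Qed.

Lemma law_sub (A B : pred T) : (forall h, A h -> B h) ->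
  \sum_(h | A h) p h <= \sum_(h | B h) p h.
Proof.
move=> AB; rewrite big_mkcond [leRHS]big_mkcond; apply: ler_sum => h _.
by case: ifP => [/AB ->//|_]; case: ifP.
Qed.

End LawUnion.

Section HypergraphDeviations.
Context {R : realType} (N : nat) (LL : {fset nat}) (dt : {set 'I_N} -> R).
Variables (p : {set {set 'I_N}} -> R) (K : nat).
Local Notation V := (possible_edges N LL).
Local Notation q := (edge_prob dt).
Local Notation d := (dtot LL dt).
Hypothesis N_ge3 : (3 <= N)%N.
Hypothesis LL_ge2 : forall l : nat, l \in LL -> (2 <= l)%N.
Hypothesis p_ge0 : forall h, 0 <= p h.
Hypothesis p_supp : forall h : {set {set 'I_N}}, ~~ (h \subset V) -> p h = 0.
Hypothesis p_sup : forall F : {set {set 'I_N}}, F \subset V ->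
  \sum_(h : {set {set 'I_N}} | F \subset h) p h = \prod_(e in F) q e.
Hypothesis q01 : forall e, e \in V -> 0 <= q e <= 1.
Hypothesis K_ge : forall e, e \in V -> (#|e| * #|e|.-1 <= K)%N.
Hypothesis K_gt0 : (0 < K)%N.
Hypothesis d_gt0 : 0 < d.

Let N_gt0 : (0 < N)%N. Proof. exact: leq_trans N_ge3. Qed.
Let N_gt0R : 0 < N%:R :> R. Proof. by rewrite ltr0n. Qed.
Let K_gt0R : 0 < K%:R :> R. Proof. by rewrite ltr0n. Qed.
Let r_gt0 : 0 < Num.sqrt d. Proof. by rewrite sqrtr_gt0. Qed.
Let r2 : Num.sqrt d ^+ 2 = d. Proof. by rewrite sqr_sqrtr// ltW. Qed.

Implicit Types (b : 'I_N -> bool) (a : 'I_N -> nat).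

Definition mean_sum (g : 'I_N -> 'I_N -> R) : R := \sum_(e in V) q e * edge_weight g e.

(** Products of two coordinates have denominator [16 N], so the cut at [16 * sqrt d] is the cut of
    the lattice products at [sqrt d / N]. *)
Definition light_part (b : 'I_N -> bool) (a : 'I_N -> nat) (i j : 'I_N) : R :=
  if (a i)%:R * (a j)%:R <= 16 * Num.sqrt d
  then lattice_vec b a i * lattice_vec b a j else 0.

Lemma light_part_norm b a i j : `|light_part b a i j| <= Num.sqrt d / N%:R.
Proof.
rewrite /light_part; case: ifP => h; last by rewrite normr0 divr_ge0// ltW.
rewrite lattice_vec_norm// ler_pdivrMr ?mulr_gt0//.
by apply: le_trans h _; rewrite le_eqVlt; apply/orP; left; apply/eqP; field; rewrite gt_eqF.
Qed.

Lemma light_deviation b a : (\sum_i a i ^ 2 <= 16 * N)%N ->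
  \sum_(h : {set {set 'I_N}} | 16 * K%:R * Num.sqrt d
     <= `|\sum_(e in h) edge_weight (light_part b a) e - mean_sum (light_part b a)|) p h
  <= 2 * expR (- (7 * N%:R)).
Proof.
move=> ha; set g := light_part b a; set r := Num.sqrt d.
(* An edge weight is at most [K * r / N], so this is the largest scale for which Bernstein's
   condition [1 / 2] is ensured. The threshold becomes [8 N] and the variance term is at most [N],
   which leaves the exponent [7 N]. *)
pose s := N%:R / (2 * K%:R * r).
have s0 : 0 < s by rewrite divr_gt0// !mulr_gt0.
have st : s * (16 * K%:R * r) = 8 * N%:R by rewrite /s; field; rewrite !gt_eqF.
have wK e : e \in V -> `|s * edge_weight g e| <= 2^-1.
  move=> eV; rewrite normrM (ger0_norm (ltW s0)).
  have := @edge_weight_norm R N g (r / N%:R) e (light_part_norm b a).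
  move=> /(ler_wpM2l (ltW s0)) /le_trans; apply.
  apply: (@le_trans _ _ (s * (K%:R * (r / N%:R)))).
    by rewrite ler_wpM2l ?(ltW s0)// ler_wpM2r ?divr_ge0 ?(ltW r_gt0)// ler_nat K_ge.
  by rewrite le_eqVlt; apply/orP; left; apply/eqP; rewrite /s; field; rewrite !gt_eqF.
have var : 2 * \sum_(e in V) q e * (s * edge_weight g e) ^+ 2 <= N%:R.
  have g2 : \sum_i \sum_j g i j ^+ 2 <= 1.
    apply: le_trans (sum_lattice_sq b N_gt0 ha); apply: ler_sum => i _; apply: ler_sum => j _.
    by rewrite /g /light_part; case: ifP => // _; rewrite expr0n sqr_ge0.
  apply: (@le_trans _ _ (2 * (s ^+ 2 * K%:R * (3 / 2 * (d / N%:R))))).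
    rewrite ler_wpM2l//.
    apply: (@le_trans _ _ (s ^+ 2 * K%:R * \sum_(e in V) q e * edge_weight (fun i j => g i j ^+ 2) e)).
      rewrite mulr_sumr; apply: ler_sum => e eV; have /andP[q0 _] := q01 eV.
      rewrite exprMn [leRHS](_ : _ = q e * (s ^+ 2 * (K%:R * edge_weight (fun i j => g i j ^+ 2) e))); last by ring.
      rewrite ler_wpM2l// ler_wpM2l ?sqr_ge0//.
      apply: le_trans (edge_weight_sq _ _) _; rewrite ler_wpM2r ?ler_nat ?K_ge//.
      by apply: edge_weight_ge0 => i j; exact: sqr_ge0.
    apply: ler_wpM2l; first by rewrite mulr_ge0// sqr_ge0.
    have := @mean_edge_weight R N LL dt LL_ge2 (fun i j => g i j ^+ 2) N_ge3
      (fun i j => sqr_ge0 _).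
    move=> /le_trans; apply.
    by rewrite ler_piMr// mulr_ge0 ?divr_ge0// ltW.
  have K1 : 1 <= K%:R :> R by rewrite ler1n.
  rewrite /s -r2 -/r [leLHS](_ : _ = 3 / 4 * (N%:R / K%:R)); last first.
    by field; rewrite !gt_eqF.
  have : N%:R / K%:R <= N%:R :> R by rewrite ler_pdivrMr// ler_peMr.
  have := ltW N_gt0R; lra.
have dev (c : R) : c ^+ 2 = 1 ->
    \sum_(h : {set {set 'I_N}} | 16 * K%:R * r
       <= c * (\sum_(e in h) edge_weight g e - mean_sum g)) p h <= expR (- (7 * N%:R)).
  move=> c2; have c1 : `|c| = 1.
    by apply/eqP; rewrite -(@eqrXn2 _ 2)// expr1n real_normK ?num_real// c2.
  have := @law_bernstein R _ p V q p_ge0 p_supp p_sup q01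
    (fun e => c * (s * edge_weight g e)) (8 * N%:R).
  have w' e : e \in V -> `|c * (s * edge_weight g e)| <= 2^-1.
    by move=> eV; rewrite normrM c1 mul1r wK.
  move=> /(_ w') hB; apply: le_trans (le_trans hB _).
    apply: law_sub => // h hh.
    rewrite (_ : _ - _ = s * (c * (\sum_(e in h) edge_weight g e - mean_sum g))).
      by rewrite -st ler_pM2l.
    rewrite !mulrBr /mean_sum !mulr_sumr; congr (_ - _); apply: eq_bigr => e _; ring.
  rewrite ler_expR.
  under eq_bigr => e _ do rewrite exprMn c2 mul1r.
  lra.
apply: (@le_trans _ _ (expR (- (7 * N%:R)) + expR (- (7 * N%:R)))); last by lra.
apply: le_trans (lerD (dev 1 (expr1n _ _)) (dev (-1) _)); last by rewrite sqrrN expr1n.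
apply: le_trans (law_or _ _ _) => //.
apply: law_sub => // h; rewrite mul1r mulN1r.
by rewrite ler_normr.
Qed.

Definition light_bad (h : {set {set 'I_N}}) : bool := [exists z, (z \in lattice_net N) &&
  (16 * K%:R * Num.sqrt d <= `|\sum_(e in h) edge_weight (light_part z.1 (fun i => z.2 i)) e
      - mean_sum (light_part z.1 (fun i => z.2 i))|)].

(** Union bound over [64 ^ N] vectors: [64 * e ^ - 7 <= 2 / e] because [64 = 2 ^ 6 <= e ^ 6]. *)
Lemma light_bad_le : \sum_(h | light_bad h) p h <= 2 * (expR 1 / 2) ^- N.
Proof.
apply: (le_trans (law_union p_ge0 _ _)).
apply: (@le_trans _ _ (\sum_(z in lattice_net N) 2 * expR (- (7 * N%:R)))).
  by apply: ler_sum => z; rewrite inE => hz; exact: light_deviation.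
rewrite sumr_const -[leLHS]mulr_natl.
apply: (le_trans (ler_wpM2r _ (@card_lattice_net R N))).
  by rewrite mulr_ge0 ?expR_ge0.
rewrite mulrCA ler_pM2l// expRN (mulrC 7) expRM_natl -exprVn -exprMn -exprVn.
have /andP[e2 _] := @expR1_bounds R.
have e7 : expR 7 = expR 1 ^+ 7 :> R by rewrite -expRM_natl mulr1.
rewrite lerXn2r ?nnegrE ?mulr_ge0 ?invr_ge0 ?divr_ge0 ?expR_ge0// e7 invf_div.
have e0 := expR_gt0 (1 : R).
rewrite exprS invfM mulrA [leLHS]mulrAC ler_pdivlMr// divfK ?gt_eqF//.
rewrite ler_pdivrMr ?exprn_gt0//.
have : 2 ^+ 6 <= expR 1 ^+ 6 :> R by rewrite lerXn2r// nnegrE ltW.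
lra.
Qed.

Variable theta : R.
Hypothesis theta_ge0 : 0 <= theta.
Local Notation kappa := (K%:R * (theta + 4)).
Implicit Types (S T : {set 'I_N}) (h : {set {set 'I_N}}).

Lemma block_sum_adjacency h S T : block_sum (adjacency R h) S T
  = \sum_(e in h) edge_weight (fun i j => ((i \in S) && (j \in T))%:R) e.
Proof.
rewrite -adjacency_sum /block_sum big_mkcond; apply: eq_bigr => i _.
case: (i \in S) => /=; last by rewrite big1// => j _; rewrite mulr0.
rewrite big_mkcond; apply: eq_bigr => j _.
by case: (j \in T); rewrite ?mulr1 ?mulr0.
Qed.

(** Dividing edge weights by [K] brings them into the unit interval for [law_poisson]; this is the
    origin of the factor [K] in front of [t]. *)
Lemma block_deviation S T s t : 0 <= s ->
  \sum_(h : {set {set 'I_N}} | 3 / 2 * (d / N%:R) * (#|S|%:R * #|T|%:R) * (expR s - 1) + K%:R * t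
      <= s * block_sum (adjacency R h) S T) p h <= expR (- t).
Proof.
move=> s0; pose g i j : R := ((i \in S) && (j \in T))%:R.
have g0 i j : 0 <= g i j by [].
have g1 i j : `|g i j| <= 1 by rewrite /g normr_nat lern1 leq_b1.
have es0 : 0 <= expR s - 1 by rewrite subr_ge0 -expR0 ler_expR.
have w01 e : e \in V -> 0 <= edge_weight g e / K%:R <= 1.
  move=> eV; rewrite divr_ge0 ?edge_weight_ge0//= ler_pdivrMr// mul1r.
  apply: (@le_trans _ _ ((#|e| * #|e|.-1)%:R * 1)); last by rewrite mulr1 ler_nat K_ge.
  by apply: le_trans (edge_weight_norm e g1); exact: ler_norm.
set mu := 3 / 2 * (d / N%:R) * (#|S|%:R * #|T|%:R).
have hmu : \sum_(e in V) q e * edge_weight g e <= mu.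
  apply: (le_trans (mean_edge_weight dt LL_ge2 N_ge3 g0)).
  rewrite ler_wpM2l ?mulr_ge0 ?divr_ge0 ?(ltW d_gt0)//.
  have -> : #|S|%:R * #|T|%:R = \sum_(i in S) #|T|%:R :> R.
    by rewrite sumr_const mulr_natl.
  rewrite [leRHS]big_mkcond; apply: ler_sum => i _.
  rewrite /g; case: (i \in S) => /=; last by rewrite big1.
  by rewrite -sum1_card natr_sum [leRHS]big_mkcond; apply: ler_sum => j _; case: (j \in T).
have := @law_poisson R _ p V q p_ge0 p_supp p_sup q01 (fun e => edge_weight g e / K%:R) s
  (mu * (expR s - 1) / K%:R + t) w01.
move=> hP; apply: le_trans (le_trans hP _).
  apply: law_sub => // h; rewrite block_sum_adjacency -/g => hh.
  rewrite -mulr_suml -(ler_pM2l K_gt0R).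
  rewrite [leRHS](_ : _ = s * \sum_(e in h) edge_weight g e); last by field; rewrite gt_eqF.
  by rewrite [leLHS](_ : _ = mu * (expR s - 1) + K%:R * t)//; field; rewrite gt_eqF.
rewrite ler_expR; under eq_bigr => e _ do rewrite mulrA.
rewrite -mulr_suml.
have : (expR s - 1) * ((\sum_(e in V) q e * edge_weight g e) / K%:R)
    <= (expR s - 1) * (mu / K%:R).
  by rewrite ler_wpM2l// ler_wpM2r// invr_ge0 ltW.
lra.
Qed.

Definition discrepancy_fails h S T : bool :=
  ~~ ((block_sum (adjacency R h) S T <= 3 * (d / N%:R) * (#|S|%:R * #|T|%:R)
                       + kappa * (#|T|%:R * log_card T))
  && (block_sum (adjacency R h) S T <= 3 / 2 * (d / N%:R) * (#|S|%:R * #|T|%:R)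
                         * expR (log_card T / 2) + 2 * kappa * #|T|%:R)).

Definition discrepancy_bad h : bool :=
  [exists T : {set 'I_N}, (0 < #|T|)%N && [exists S : {set 'I_N},
     (#|S| <= #|T|)%N && discrepancy_fails h S T]].

Lemma discrepancy_good h : ~~ discrepancy_bad h -> discrepancy (adjacency R h) d kappa.
Proof.
move=> hb S T T0 ST; apply/andP; apply: contraR hb => hf.
by apply/existsP; exists T; rewrite T0/=; apply/existsP; exists S; rewrite ST.
Qed.

(** At exponent 1, [e - 1 <= 2] turns [3 / 2] into 3. At exponent [X / 2],
    [expR s - 1 <= s * expR s] allows division by [X / 2], and the factor [X] in [t] cancels: the
    second bound carries no logarithm in its additive term. *)
Lemma discrepancy_fails_le S T : (0 < #|T|)%N ->
  \sum_(h | discrepancy_fails h S T) p h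
  <= 2 * expR (- ((theta + 4) * (#|T|%:R * log_card T))).
Proof.
move=> T0; set t := (theta + 4) * _; have X1 := @log_card_ge1 R N T T0.
set X := log_card T in X1 t *; set mu := 3 / 2 * (d / N%:R) * (#|S|%:R * #|T|%:R).
have mu0 : 0 <= mu by rewrite !mulr_ge0 ?invr_ge0 ?(ltW d_gt0).
apply: (@le_trans _ _ (expR (- t) + expR (- t))); last by lra.
apply: le_trans (lerD (block_deviation S T t ler01)
  (block_deviation S T t (_ : 0 <= X / 2))); last by lra.
apply: le_trans (law_or _ _ _) => //; apply: law_sub => // h.
rewrite /discrepancy_fails negb_and -!ltNge -/mu -/X.
set f := block_sum _ _ _; move=> /orP[hf|hf]; apply/orP; [left|right].
  rewrite mul1r; apply: le_trans (ltW hf).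
  have /andP[_ e3] := @expR1_bounds R.
  rewrite [leRHS](_ : _ = mu * 2 + K%:R * t); last by rewrite /mu /t; field; rewrite gt_eqF.
  by rewrite lerD2r ler_wpM2l//; lra.
have X0 : 0 < X / 2 by lra.
apply: (@le_trans _ _ (X / 2 * (mu * expR (X / 2) + 2 * kappa * #|T|%:R))); last first.
  by rewrite ler_pM2l// ltW.
have := ler_wpM2l mu0 (expR_subr1_le (X / 2)).
rewrite (_ : X / 2 * (_ + _) = mu * (X / 2 * expR (X / 2)) + K%:R * t); first by lra.
by rewrite /t; field.
Qed.

Lemma discrepancy_bad_le : \sum_(h | discrepancy_bad h) p h <= N%:R `^ (- theta).
Proof.
apply: (le_trans (law_union p_ge0 _ _)).
apply: le_trans (sum_discrepancy_tail N_gt0 theta_ge0).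
apply: ler_sum => T T0; apply: (le_trans (law_union p_ge0 _ _)).
by apply: ler_sum => S _; exact: discrepancy_fails_le.
Qed.

End HypergraphDeviations.

(** * The regularized adjacency matrix *)

(** Since [1 <= sqrt tau], the excess [11 * K + 3 / 2] over [5 * K] may be charged to the [sqrt tau]
    term. There [128 * (1 + 1 / 9)] exceeds 79 by more than 63, and 63 times [kap], with
    [kap >= 4 * K >= 8], absorbs the excess and the constant 396. *)
Lemma constant_bound {R : realType} (L : nat) (tau theta : R) :
    (2 <= L)%N -> 1 < tau -> 0 < theta ->
  16 * (L * L.-1)%:R + 3 / 2
    + Num.sqrt tau * (396 + 79 * ((L * L.-1)%:R * (theta + 4)))
  <= (5 * L%:R + 1) * (L%:R - 1) + alpha0 L tau theta * Num.sqrt tau.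
Proof.
move=> L2 tau1 th0.
have Lp : L.-1%:R = L%:R - 1 :> R by case: L L2 => // n _; rewrite -[n.+1%:R]natr1 addrK.
have L2R : 2 <= L%:R :> R by rewrite ler_nat.
rewrite natrM Lp /alpha0.
set x : R := L%:R in L2R *; set K := x * (x - 1).
have K2 : 2 <= K by rewrite /K; nra.
have s1 : 1 <= Num.sqrt tau by rewrite -sqrtr1 ler_wsqrtr// ltW.
have /andP[e2 e3] := @expR1_bounds R.
set e := expR 1 in e2 e3 *; set s := Num.sqrt tau in s1 *.
have ee : 1 / 9 <= 1 / e ^+ 2.
  by rewrite ler_pdivlMr ?exprn_gt0//; [nra|lra].
have t0 : 0 <= 32 / tau * (1 + e ^+ 2).
  rewrite mulr_ge0 ?divr_ge0//; first by lra.
  by rewrite addr_ge0// sqr_ge0.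
set kap := K * (theta + 4).
have kap4 : 4 * K <= kap by rewrite /kap; nra.
rewrite (_ : 128 * x * (x - 1) * (theta + 4) = 128 * kap); last by rewrite /kap /K; ring.
rewrite (_ : (5 * x + 1) * (x - 1) = 5 * K + (x - 1)); last by rewrite /K; ring.
have h1 : 128 * kap * (1 + 1 / 9) <= 128 * kap * (1 + 1 / e ^+ 2).
  by rewrite ler_wpM2l//; lra.
have h2 : 396 + 79 * kap + (11 * K + 3 / 2) <=
    16 + 32 / tau * (1 + e ^+ 2) + 128 * kap * (1 + 1 / e ^+ 2) by lra.
have s0 : 0 <= s by lra.
have h3 := ler_wpM2l s0 h2.
have h4 : 11 * K + 3 / 2 <= s * (11 * K + 3 / 2) by rewrite ler_peMl//; lra.
move: h3; set al := _ + 128 * kap * _ => h3.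
rewrite (mulrC al); lra.
Qed.

Section RegularizedNorm.
Context {R : realType} (N : nat) (LL : {fset nat}) (dt : {set 'I_N} -> R).
Variables (p : {set {set 'I_N}} -> R) (K : nat) (tau theta : R).
Local Notation V := (possible_edges N LL).
Local Notation q := (edge_prob dt).
Local Notation d := (dtot LL dt).
Hypothesis N_ge3 : (3 <= N)%N.
Hypothesis LL_ge2 : forall l : nat, l \in LL -> (2 <= l)%N.
Hypothesis p_ge0 : forall h, 0 <= p h.
Hypothesis p_supp : forall h : {set {set 'I_N}}, ~~ (h \subset V) -> p h = 0.
Hypothesis p_sup : forall F : {set {set 'I_N}}, F \subset V ->
  \sum_(h : {set {set 'I_N}} | F \subset h) p h = \prod_(e in F) q e.
Hypothesis d_gt0 : 0 < d.
Hypothesis tau_ge1 : 1 <= tau.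
Hypothesis theta_ge0 : 0 <= theta.

Local Notation kappa := (K%:R * (theta + 4)).

Definition law_adjacency : 'M[R]_N :=
  \matrix_(i, j) \sum_h p h * adjacency R h i j.

Lemma adjacency_ge0 (h : {set {set 'I_N}}) i j : 0 <= adjacency R h i j.
Proof. by rewrite mxE; case: ifP. Qed.

Lemma adjacency_sym (h : {set {set 'I_N}}) i j : adjacency R h i j = adjacency R h j i.
Proof.
rewrite !mxE eq_sym; case: ifP => // _; congr (_%:R); apply: eq_card => e.
by rewrite !inE [(i \in e) && _]andbC.
Qed.

Lemma law_adjacency_sum g :
  \sum_i \sum_j law_adjacency i j * g i j = mean_sum LL dt g.
Proof.
rewrite /mean_sum -(law_mean p_supp p_sup) pair_bigA/=.
under eq_bigr => x _ do rewrite mxE mulr_suml.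
rewrite exchange_big; apply: eq_bigr => h _.
rewrite -adjacency_sum mulr_sumr -(pair_bigA _ (fun i j => p h * adjacency R h i j * g i j))/=.
by apply: eq_bigr => i _; rewrite mulr_sumr; apply: eq_bigr => j _; rewrite mulrA.
Qed.

Lemma light_good h b a : ~~ light_bad LL dt K h -> (\sum_i a i ^ 2 <= 16 * N)%N ->
  `|\sum_(e in h) edge_weight (light_part LL dt b a) e
      - mean_sum LL dt (light_part LL dt b a)| <= 16 * K%:R * Num.sqrt d.
Proof.
move=> hb ha; rewrite leNgt; apply: contra hb => hf; apply/existsP.
have a4 i : (a i < (4 * N).+1)%N.
  rewrite ltnS -leq_sqr expnMn.
  have h1 : (a i ^ 2 <= 16 * N)%N.
    by apply: leq_trans ha; rewrite (bigD1 i)//= leq_addr.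
  by apply: leq_trans h1 _; rewrite leq_mul2l/= expnS expn1 leq_pmulr// (leq_trans _ N_ge3).
pose z : {ffun 'I_N -> bool} * {ffun 'I_N -> 'I_(4 * N).+1} :=
  ([ffun i => b i], [ffun i => Ordinal (a4 i)]).
have zb : (z.1 : 'I_N -> bool) = b by apply: funext => i; rewrite ffunE.
have za : (fun i => z.2 i : nat) = a by apply: funext => i; rewrite ffunE.
exists z; rewrite zb za (ltW hf) andbT inE.
by under eq_bigr => i _ do rewrite (_ : (z.2 i : nat) = a i) ?ffunE//.
Qed.

Lemma regularized_bilin_le h b a :
    ~~ light_bad LL dt K h -> ~~ discrepancy_bad LL dt K theta h ->
    (\sum_i a i ^ 2 <= 16 * N)%N ->
  `|bilin (restrict_mx (low_rows (adjacency R h) (tau * d)) (adjacency R h)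
           - restrict_mx (low_rows (adjacency R h) (tau * d)) law_adjacency)
      (lattice_vec b a) (lattice_vec b a)|
  <= (16 * K%:R + 3 / 2 + Num.sqrt tau * (396 + 79 * kappa)) * Num.sqrt d.
Proof.
move=> hlight hdisc ha; set I := low_rows _ _.
have N0 : (0 < N)%N by exact: leq_trans N_ge3.
have N0R : 0 < N%:R :> R by rewrite ltr0n.
have r0 : 0 < Num.sqrt d by rewrite sqrtr_gt0.
(* The form of the restricted matrix at the lattice vector is the form of the full matrix at its
   restriction, again in the net. The support of [a'] lies in [I], where the row sums are
   bounded. *)
pose a' i := if i \in I then a i else 0%N.
have ha' : (\sum_i a' i ^ 2 <= 16 * N)%N.
  by apply: leq_trans ha; apply: leq_sum => i _; rewrite /a'; case: ifP.
pose y := lattice_vec b a' : 'I_N -> R.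
pose A := adjacency R h; pose lp := light_part LL dt b a'.
pose hv i j : R := if (a' i)%:R * (a' j)%:R <= 16 * Num.sqrt d then 0 else y i * y j.
have split_y i j : y i * y j = lp i j + hv i j.
  by rewrite /lp /light_part /hv; case: ifP; rewrite ?addr0 ?add0r.
have hvN i j : `|hv i j| <= (y i * y j) ^+ 2 * (N%:R / Num.sqrt d).
  rewrite /hv; case: ifPn => [_|]; first by rewrite normr0 mulr_ge0 ?sqr_ge0 ?divr_ge0// ltW.
  rewrite -ltNge => h1; rewrite -(real_normK (num_real (y i * y j))) /y lattice_vec_norm//.
  set m := _ / _; have m0 : 0 <= m by rewrite divr_ge0// mulr_ge0.
  rewrite expr2 -mulrA ler_peMr// mulrA ler_pdivlMr// mul1r /m.
  rewrite [leRHS](_ : _ = (a' i)%:R * (a' j)%:R / 16); last by field; rewrite gt_eqF.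
  by lra.
rewrite (_ : bilin _ _ _ = (\sum_(e in h) edge_weight lp e - mean_sum LL dt lp)
      + \sum_i \sum_j A i j * hv i j - \sum_i \sum_j law_adjacency i j * hv i j); last first.
  rewrite -adjacency_sum -law_adjacency_sum /bilin -!sumrN -!big_split/=.
  apply: eq_bigr => i _; rewrite -!sumrN -!big_split/=; apply: eq_bigr => j _.
  rewrite -/A [RHS](_ : _ = (A i j - law_adjacency i j) * (lp i j + hv i j)); last by ring.
  rewrite -split_y /y /lattice_vec /a' !mxE.
  by case: (i \in I); case: (j \in I); rewrite /= ?(mulr0, mul0r, subr0).
have D0 : d <= tau * d by rewrite ler_peMl// ltW.
have h1 := light_good b hlight ha'.
have h2 : `|\sum_i \sum_j A i j * hv i j| <= Num.sqrt tau * Num.sqrt d * (396 + 79 * kappa).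
  have kap0 : 0 <= kappa by rewrite mulr_ge0// addr_ge0.
  have A_row u : (0 < a' u)%N -> \sum_v A u v <= tau * d.
    by rewrite /a'; case: ifP => //; rewrite inE.
  have := @heavy_sum_le R N a' (fun i j => A i j) d (tau * d) kappa N0 d_gt0 D0 kap0 ha'
    (adjacency_ge0 h) (adjacency_sym h) A_row (discrepancy_good hdisc).
  rewrite sqrtrM ?(le_trans ler01)// => hs.
  have n16 : 0 < 16 * N%:R :> R by rewrite mulr_gt0.
  rewrite -(ler_pM2l n16).
  have k0 : 0 <= Num.sqrt tau * Num.sqrt d * N%:R * kappa.
    by rewrite !mulr_ge0 ?sqrtr_ge0// addr_ge0.
  (* After division by the [16 N] of the lattice products, [6336 / 16 = 396] and
     [1260 / 16 < 79]. *)
  apply: (@le_trans _ _ (Num.sqrt tau * Num.sqrt d * N%:R * (6336 + 1260 * kappa))); last by lra.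
  apply: le_trans hs.
  apply: (@le_trans _ _ (16 * N%:R * \sum_i \sum_j A i j * `|hv i j|)).
    rewrite ler_pM2l//; apply: le_trans (ler_norm_sum _ _ _) _; apply: ler_sum => i _.
    apply: le_trans (ler_norm_sum _ _ _) _; apply: ler_sum => j _.
    by rewrite normrM (ger0_norm (adjacency_ge0 _ _ _)).
  rewrite mulr_sumr; apply: ler_sum => i _; rewrite mulr_sumr [leRHS]big_mkcond.
  apply: ler_sum => j _; rewrite /hv; case: ifPn => [hle|].
    by rewrite normr0 !mulr0; case: ifP => // _; rewrite !mulr_ge0// adjacency_ge0.
  rewrite -ltNge => ->; rewrite /y lattice_vec_norm// le_eqVlt; apply/orP; left; apply/eqP.
  by field; rewrite gt_eqF.
have h3 : `|\sum_i \sum_j law_adjacency i j * hv i j| <= 3 / 2 * Num.sqrt d.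
  have EA0 i j : 0 <= law_adjacency i j.
    by rewrite mxE; apply: sumr_ge0 => k _; rewrite mulr_ge0// adjacency_ge0.
  pose g i j := (y i * y j) ^+ 2.
  apply: (@le_trans _ _ (mean_sum LL dt g * (N%:R / Num.sqrt d))).
    rewrite -law_adjacency_sum mulr_suml.
    apply: le_trans (ler_norm_sum _ _ _) _; apply: ler_sum => i _; rewrite mulr_suml.
    apply: le_trans (ler_norm_sum _ _ _) _; apply: ler_sum => j _.
    by rewrite normrM (ger0_norm (EA0 _ _)) -mulrA ler_wpM2l.
  apply: (@le_trans _ _ (3 / 2 * (d / N%:R) * (N%:R / Num.sqrt d))).
    rewrite ler_wpM2r ?divr_ge0// ?(ltW r0)//.
    have := @mean_edge_weight R N LL dt LL_ge2 g N_ge3 (fun i j => sqr_ge0 _).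
    move=> /le_trans; apply; rewrite ler_piMr ?mulr_ge0 ?invr_ge0 ?(ltW d_gt0)//.
    exact: sum_lattice_sq.
  rewrite -{1}(sqr_sqrtr (ltW d_gt0)) le_eqVlt; apply/orP; left; apply/eqP.
  by field; rewrite !gt_eqF.
rewrite [leRHS](_ : _ = 16 * K%:R * Num.sqrt d + Num.sqrt tau * Num.sqrt d * (396 + 79 * kappa)
  + 3 / 2 * Num.sqrt d); last by ring.
apply: le_trans (ler_normB _ _) _; apply: lerD => //.
by apply: le_trans (ler_normD _ _) _; apply: lerD.
Qed.

End RegularizedNorm.

(** * From the probability space to the law of the hypergraph *)

Section FiniteValued.
Context (R : realType) (disp : measure_display) (Omega : measurableType disp).
Variables (P : probability Omega R) (X : finType) (H : Omega -> X).
Hypothesis mH : forall h, measurable [set w | H w = h]%classic.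

Definition law (h : X) : R := fine (P [set w | H w = h]%classic).

Lemma law_ge0 h : 0 <= law h.
Proof. by rewrite /law fine_ge0. Qed.

Lemma lawE h : P [set w | H w = h]%classic = (law h)%:E.
Proof. by rewrite /law fineK// fin_num_measure. Qed.

Lemma event_bigcup (B : pred X) : [set w | B (H w)]%classic =
  (\bigcup_(h in [set` B]) [set w | H w = h])%classic.
Proof.
by apply/seteqP; split => [w /= Bw|w [h /= Bh /= ->]//]; exists (H w).
Qed.

Lemma probability_event (B : pred X) :
  P [set w | B (H w)]%classic = (\sum_(h | B h) law h)%:E.
Proof.
rewrite event_bigcup measure_fin_bigcup//; last first.
  by move=> h k _ _ [w [/= <- <-]].
rewrite -(@bigfs _ _ _ _ (index_enum X)) ?index_enum_uniq//; last first.
  by move=> h _; rewrite mem_index_enum.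
by rewrite -sumEFin; apply: eq_bigr => h _; exact: lawE.
Qed.

Lemma expectation_law (f : X -> R) : (forall h, 0 <= f h) ->
  ('E_P[fun w => f (H w)])%E = (\sum_h law h * f h)%:E.
Proof.
move=> f0; rewrite unlock.
transitivity (\int[P]_w (\sum_h (f h * \1_[set w | H w = h]%classic w)%:E))%E.
  apply: eq_integral => w _; rewrite sumEFin (bigD1 (H w))//= big1 => [|h hw].
    by rewrite indicE mem_set// mulr1 addr0.
  by rewrite indicE memNset ?mulr0//= => e; move: hw; rewrite e eqxx.
rewrite ge0_integral_sum//; last 2 first.
- move=> h; apply/measurable_EFinP; apply: measurable_funM.
    exact: measurable_cst.
  by apply: measurable_indic; exact: mH.
- by move=> h w _; rewrite lee_fin mulr_ge0// f0.
rewrite -sumEFin; apply: eq_bigr => h _.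
under eq_integral => w _ do rewrite EFinM.
rewrite ge0_integralZl_EFin//; last first.
  by apply/measurable_EFinP; apply: measurable_indic; exact: mH.
by rewrite integral_indic// setIT EFinM muleC; congr (_ * _)%E; exact: lawE.
Qed.

End FiniteValued.

Section EdgeLaw.
Context (R : realType) (disp : measure_display) (Omega : measurableType disp).
Variables (P : probability Omega R) (N : nat) (LL : {fset nat}).
Variables (dt : {set 'I_N} -> R) (H : Omega -> {set {set 'I_N}}).
Hypothesis H_ER : inhomogeneous_ER P LL dt H.

Lemma measurable_ER h : measurable [set w | H w = h]%classic.
Proof.
have -> : [set w | H w = h]%classic = (\bigcap_(e in [set: {set 'I_N}])
    (if e \in h then [set w | e \in H w] else ~` [set w | e \in H w]))%classic.
  apply/seteqP; split => [w /= <- e _|w /= hw].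
    by case: ifP => //= ->.
  apply/finset.setP => e; have := hw e I.
  by case: ifP => eh /= => [->//|/negP/negbTE ->].
apply: fin_bigcap_measurable => // e _.
by case: ifP => _; [|apply: measurableC]; exact: ER_measurable H_ER e.
Qed.

Lemma law_support (h : {set {set 'I_N}}) : ~~ (h \subset possible_edges N LL) ->
  law P H h = 0.
Proof.
move=> hV; rewrite /law (_ : [set w | H w = h]%classic = set0) ?measure0//.
by apply/seteqP; split => // w /= hw; move: hV; rewrite -hw (ER_support H_ER).
Qed.

Lemma law_superset (F : {set {set 'I_N}}) : F \subset possible_edges N LL ->
  \sum_(h : {set {set 'I_N}} | F \subset h) law P H h = \prod_(e in F) edge_prob dt e.
Proof.
move=> FV; apply: EFin_inj.
rewrite -(probability_event P measurable_ER (fun h : {set {set 'I_N}} => F \subset h)).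
transitivity (P (\bigcap_(e in [set` F]) [set w | e \in H w])%classic).
  congr (P _); apply/seteqP; split => w /=.
    by move=> /fintype.subsetP h e eF; exact: h.
  by move=> h; apply/fintype.subsetP => e eF; exact: h.
rewrite (ER_independent H_ER)// -prodEFin; apply: eq_bigr => e eF.
by rewrite (ER_prob H_ER)// (fintype.subsetP FV).
Qed.

Lemma expected_adjacency_law : expected_adjacency P H = law_adjacency (law P H).
Proof.
apply/matrixP => i j; rewrite !mxE.
by rewrite (expectation_law P measurable_ER (f := fun h => adjacency R h i j)) => [//|h];
  exact: adjacency_ge0.
Qed.

End EdgeLaw.

Lemma law_adjacency_sym (R : realType) N (p : {set {set 'I_N}} -> R) i j :
  law_adjacency p i j = law_adjacency p j i.
Proof. by rewrite !mxE; apply: eq_bigr => h _; rewrite adjacency_sym. Qed.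

Lemma restrict_sub_sym (R : realType) N (I : {set 'I_N}) (A B : 'M[R]_N) :
    (forall i j, A i j = A j i) -> (forall i j, B i j = B j i) ->
  forall i j, (restrict_mx I A - restrict_mx I B) i j = (restrict_mx I A - restrict_mx I B) j i.
Proof. by move=> hA hB i j; rewrite !mxE andbC hA hB. Qed.

Lemma small_dimension_bound (R : realType) (N : nat) : (N <= 2)%N ->
  1 <= 2 * (expR 1 / 2) ^- N :> R.
Proof.
have /andP[e2 e3] := @expR1_bounds R; move=> N2.
have e1 : 1 <= expR 1 / 2 :> R by lra.
have h : (expR 1 / 2) ^+ N <= 2 :> R.
  by apply: (le_trans (ler_weXn2l e1 N2)); nra.
have h0 : 0 < (expR 1 / 2) ^+ N :> R by rewrite exprn_gt0//; lra.
by rewrite ler_pdivlMr// mul1r.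
Qed.

(** * Combination of the good events *)

Section Concentration.
Context {R : realType} (N : nat) (LL : {fset nat}) (dt : {set 'I_N} -> R).
Variables (p : {set {set 'I_N}} -> R) (tau theta : R).
Local Notation V := (possible_edges N LL).
Local Notation q := (edge_prob dt).
Local Notation d := (dtot LL dt).
Hypothesis LL_neq0 : LL != fset0.
Hypothesis LL_ge2 : forall l : nat, l \in LL -> (2 <= l)%N.
Hypothesis p_ge0 : forall h, 0 <= p h.
Hypothesis p_supp : forall h : {set {set 'I_N}}, ~~ (h \subset V) -> p h = 0.
Hypothesis p_sup : forall F : {set {set 'I_N}}, F \subset V ->
  \sum_(h : {set {set 'I_N}} | F \subset h) p h = \prod_(e in F) q e.
Hypothesis q01 : forall e, e \in V -> 0 <= q e <= 1.
Hypothesis tau_gt1 : 1 < tau.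
Hypothesis theta_gt0 : 0 < theta.

Local Notation L := (\max_(l <- LL) l)%N.

Definition concentrated (h : {set {set 'I_N}}) : bool :=
  spectral_norm (restrict_mx (low_rows (adjacency R h) (tau * d)) (adjacency R h)
    - restrict_mx (low_rows (adjacency R h) (tau * d)) (law_adjacency p))
  <= Ctau L tau theta * Num.sqrt d.

(** The mean matrix vanishes by the bound on expected edge weights, and a row of nonnegative entries
    kept in [I] has sum at most 0. *)
Lemma concentrated_degenerate h : (3 <= N)%N -> d = 0 -> concentrated h.
Proof.
move=> N3 d0; rewrite /concentrated d0 sqrtr0 !mulr0.
set I := low_rows _ _; set M := _ - _.
have EA0 i j : 0 <= law_adjacency p i j.
  by rewrite mxE; apply: sumr_ge0 => k _; rewrite mulr_ge0// adjacency_ge0.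
have EAz i j : law_adjacency p i j = 0.
  apply/eqP; rewrite eq_le EA0 andbT.
  have := @mean_edge_weight R N LL dt LL_ge2 (fun=> fun=> 1) N3 (fun _ _ => ler01).
  rewrite d0 mul0r mulr0 mul0r -/(mean_sum LL dt (fun=> fun=> 1)).
  rewrite -(law_adjacency_sum p_supp p_sup); apply: le_trans.
  rewrite (bigD1 i)//= (bigD1 j)//= mulr1 -addrA lerDl.
  by rewrite addr_ge0// !sumr_ge0// => k _; rewrite ?sumr_ge0// => *; rewrite mulr_ge0.
have Az i j : i \in I -> adjacency R h i j = 0.
  rewrite inE => hi; apply/eqP; rewrite eq_le adjacency_ge0 andbT.
  apply: le_trans hi; rewrite /row_sum (bigD1 j)//= lerDl.
  by apply: sumr_ge0 => k _; exact: adjacency_ge0.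
apply: spectral_norm_le.
  exact: restrict_sub_sym (adjacency_sym h) (law_adjacency_sym p).
move=> x _; rewrite /bilin big1 ?normr0// => i _; rewrite big1// => j _.
rewrite /M mxE [X in X + _]mxE [X in _ + X]mxE [X in _ - X]mxE EAz if_same subr0.
by case: ifP => [/andP[iI _]|_]; rewrite ?Az// mul0r.
Qed.

Lemma law_concentrated : (3 <= N)%N ->
  1 - 2 * (expR 1 / 2) ^- N - N%:R `^ (- theta) <= \sum_(h | concentrated h) p h.
Proof.
move=> N3.
have eN0 : 0 <= 2 * (expR 1 / 2) ^- N :> R.
  by rewrite mulr_ge0// invr_ge0 exprn_ge0// divr_ge0// expR_ge0.
have pw0 := powR_ge0 (N%:R : R) (- theta).
have p1 : \sum_h p h = 1 := law_sum1 p_sup.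
have := dtot_ge0 LL dt; rewrite le_eqVlt => /orP[/eqP d0|d_gt0].
  rewrite (eq_bigl xpredT) => [|h]; first by rewrite p1; lra.
  exact: concentrated_degenerate.
have L2 : (2 <= L)%N.
  have /fset0Pn[l lL] := LL_neq0.
  by apply: leq_trans (LL_ge2 lL) _; exact: leq_bigmax_seq.
pose K := (L * L.-1)%N.
have K_ge e : e \in V -> (#|e| * #|e|.-1 <= K)%N.
  rewrite inE => eL; have h : (#|e| <= L)%N by exact: leq_bigmax_seq.
  by rewrite leq_mul// -!subn1 leq_sub2r.
have K_gt0 : (0 < K)%N by rewrite /K muln_gt0 (ltnW L2)/= -subn1 subn_gt0.
have th0 := ltW theta_gt0.
have good h : ~~ light_bad LL dt K h -> ~~ discrepancy_bad LL dt K theta h -> concentrated h.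
  move=> h1 h2; rewrite /concentrated.
  have := @regularized_bilin_le R N LL dt p K tau theta N3 LL_ge2 p_ge0 p_supp p_sup
    d_gt0 (ltW tau_gt1) th0 h.
  set M := _ - _; set s := _ * Num.sqrt d => hb.
  have M_sym : forall i j, M i j = M j i.
    exact: restrict_sub_sym (adjacency_sym h) (law_adjacency_sym p).
  have N0 : (0 < N)%N by exact: leq_trans N3.
  have hM : spectral_norm M <= 2 * s.
    apply: (spectral_norm_le M_sym); apply: (bilin_le_lattice M_sym N0) => b a ha.
    exact: hb.
  (* The leading 2 of [Ctau] is the loss in passing from the net to the ball. *)
  apply: (le_trans hM); rewrite /s /Ctau -mulrA ler_pM2l// ler_wpM2r ?sqrtr_ge0//.
  exact: constant_bound.
have hl := light_bad_le N3 LL_ge2 p_ge0 p_supp p_sup q01 K_ge K_gt0 d_gt0.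
have hd := discrepancy_bad_le N3 LL_ge2 p_ge0 p_supp p_sup q01 K_ge K_gt0 d_gt0 th0.
have : 1 <= \sum_(h | concentrated h) p h
    + \sum_(h | light_bad LL dt K h || discrepancy_bad LL dt K theta h) p h.
  rewrite -p1; apply: le_trans (law_or p_ge0 _ _).
  apply: law_sub => // h _; rewrite orbC; apply/negPn/negP.
  by rewrite !negb_or => /andP[/andP[h1 h2]]; rewrite good.
have := law_or p_ge0 (light_bad LL dt K) (discrepancy_bad LL dt K theta).
lra.
Qed.

End Concentration.

Theorem theorem3p4 (R : realType) (disp : measure_display)
    (Omega : measurableType disp) (P : probability Omega R)
    (N : nat) (LL : {fset nat}) (dt : {set 'I_N} -> R)
    (H : Omega -> {set {set 'I_N}}) (tau theta : R)
    (LL_neq0 : LL != fset0)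
    (LL_ge2 : forall l : nat, l \in LL -> (2 <= l)%N)
    (H_ER : inhomogeneous_ER P LL dt H)
    (tau_gt1 : 1 < tau) (theta_gt0 : 0 < theta) :
  let L := (\max_(l <- LL) l)%N in
  let d := dtot LL dt in
  let A w := adjacency R (H w) in
  let EA := expected_adjacency P H in
  let I w := low_rows (A w) (tau * d) in
  ((1 - 2 * (expR 1 / 2) ^- N - N%:R `^ (- theta))%:E <=
   P [set w | (spectral_norm (restrict_mx (I w) (A w) - restrict_mx (I w) EA)
               <= Ctau L tau theta * Num.sqrt d)%R]%classic)%E.
Proof.
cbv zeta; rewrite (expected_adjacency_law H_ER).
rewrite (probability_event P (measurable_ER H_ER)
  (concentrated LL dt (law P H) tau theta)) lee_fin.
have p0 := law_ge0 P H.
have [N3|N2] := leqP 3 N; last first.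
  apply: (@le_trans _ _ 0); last exact: sumr_ge0.
  have := @small_dimension_bound R N N2; have := powR_ge0 (N%:R : R) (- theta); lra.
by apply: law_concentrated => //; [exact: law_support H_ER|exact: law_superset H_ER
  |exact: ER_tensor H_ER].
Qed.
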